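(* Let $0<\varepsilon<1$ and $C>0$ be constants. Let $A=(a_{ij})$ be an $n\times n$ real matrix and let $x_1,\dots,x_n,y_1,\dots,y_n$ be independent Bernoulli random variables. Suppose $$\rho_b(A):=\sup_{a\in\mathbb{R}}\mathbb{P}\Big(\sum_{i,j}a_{ij}x_iy_j=a\Big)\ge n^{-C}.$$ Then there exist index sets $I_0,J_0\subseteq\{1,\dots,n\}$ of size $O_{C,\varepsilon}(1)$ and index sets $I,J\subseteq\{1,\dots,n\}$ of size $n-O_C(n^{\varepsilon})$ with $I\cap I_0=\emptyset$, $J\cap J_0=\emptyset$, and integers $k,l$ (nonzero, as they appear as denominators) and integers $k_{ii_0}$ ($i\in I$, $i_0\in I_0$) and $l_{j_0j}$ ($j_0\in J_0$, $j\in J$), all of absolute value at most $n^{O_{C,\varepsilon}(1)}$, such that for every $i\in I$ the following holds: defining, for $j\in J$, the numbers $a'_{ij}$ by $$a_{ij}=\frac{a'_{ij}}{kl}-\frac{\sum_{i_0\in I_0}k_{ii_0}a_{i_0j}}{k}-\frac{\sum_{j_0\in J_0}l_{j_0j}a_{ij_0}}{l},$$ all but $O_C(n^{\varepsilon})$ of the numbers $a'_{ij}$, $j\in J$, belong to a proper symmetric GAP $Q_i$ (depending on $i$) of rank $O_{C,\varepsilon}(1)$ and size $n^{O_{C,\varepsilon}(1)}$.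
   Context: A Bernoulli random variable takes values $\pm1$ with probability $1/2$ each. A symmetric generalized arithmetic progression (GAP) of rank $r$ is a set $Q=\{m_1g_1+\dots+m_rg_r : m_h\in\mathbb{Z},\ -N_h\le m_h\le N_h\}$ with real generators $g_1,\dots,g_r$ and nonnegative integers $N_h$; it is proper if the map $(m_1,\dots,m_r)\mapsto \sum m_hg_h$ is injective on this box; its size is $|Q|$. Notation $O_{C,\varepsilon}(1)$ denotes a quantity bounded by a constant depending only on $C,\varepsilon$; ''size $n^{O_{C,\varepsilon}(1)}$'' means at most $n^K$ for such a constant $K$; asymptotics are as $n\to\infty$. *)

(* Defs.v *)
From HB Require Import structures.
From mathcomp Require Export all_boot all_order all_algebra.
From mathcomp Require Export all_classical all_reals all_analysis.
Set Implicit Arguments.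
Unset Strict Implicit.
Unset Printing Implicit Defensive.
Import Order.TTheory GRing.Theory Num.Theory.
Import numFieldNormedType.Exports.
Local Open Scope classical_set_scope.
Local Open Scope ring_scope.

Definition is_bernoulli (R : realType) (d : measure_display)
    (T : measurableType d) (P : probability T R) (X : {RV P >-> R}) : Prop :=
  P (X @^-1` [set 1]) = (2^-1)%:E /\ P (X @^-1` [set -1]) = (2^-1)%:E.

(* Mutual (not just pairwise) independence: the product rule is required over
   every subfamily. *)
Definition independent_RVs (R : realType) (d : measure_display)
    (T : measurableType d) (P : probability T R) (I : finType)
    (X : I -> {RV P >-> R}) : Prop :=
  forall (S : {set I}) (B : I -> set R), (forall i, measurable (B i)) ->
    P (\bigcap_(i in [set` S]) (X i @^-1` B i)) =
    (\prod_(i in S) P (X i @^-1` B i))%E.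

Definition join_family (U : Type) (I J : Type) (x : I -> U) (y : J -> U)
    (s : I + J) : U :=
  match s with inl i => x i | inr j => y j end.

Definition rho_b (R : realType) (d : measure_display) (T : measurableType d)
    (P : probability T R) (n : nat) (x y : 'I_n -> {RV P >-> R})
    (A : 'M[R]_n) : \bar R :=
  ereal_sup (range (fun a : R =>
    P [set w : T | \sum_i \sum_j A i j * x i w * y j w = a])).

Definition gap_box (r : nat) (N : 'I_r -> nat) : set {ffun 'I_r -> int} :=
  [set m | forall h, (`|m h| <= N h)%N].

Definition gap_val (R : realType) (r : nat) (g : 'I_r -> R)
    (m : {ffun 'I_r -> int}) : R :=
  \sum_h g h *~ m h.

Definition sym_gap (R : realType) (r : nat) (g : 'I_r -> R) (N : 'I_r -> nat)
    : set R :=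
  gap_val g @` gap_box N.

Definition gap_proper (R : realType) (r : nat) (g : 'I_r -> R)
    (N : 'I_r -> nat) : Prop :=
  set_inj (gap_box N) (gap_val g).

(* Main.v *)
(* Idea.  For a list [v] of reals let [T v] be the probability that
   [\sum_i v_i X_i = 0], the [X_i] being differences of two independent fair
   bits.  Concentration of the signed sums forces [T v] to be large (squaring),
   and [T] is positive definite, so that any [2^t] entries of [v] may be
   replaced by [2^t] copies of one of them without decreasing [T].  Replacing
   in this way entries that are not rational combinations of small height of
   the entries already chosen divides [T] by a power of [n] each time, so the
   choice stops after boundedly many steps with a frame [W]; continuing with
   entries that do not have the current common denominator [k] over [W], [T]
   drops by [q^(1/2)] when [k] is multiplied by [q], so [k] remains polynomial.
   Hence all but [n^eps] entries satisfy [k v_i = \sum_(w in W) c_w w].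

   For the bilinear form, this applies to the vector of row forms for a
   polynomial proportion of the signs [y]; by pigeonhole the same [W] and [k],
   and for each row the same [c], serve for many [y].  Then the row
   [k A_i - \sum c_w A_w] itself is concentrated, and the linear result applied
   to it gives the progression.  In particular [J0] may be taken empty, [l = 1]
   and [J] the set of all columns. *)
Require Import Defs.
From mathcomp Require Import zify ring lra.
Set Implicit Arguments.
Unset Strict Implicit.
Unset Printing Implicit Defensive.
Import Order.TTheory GRing.Theory Num.Theory.
Import numFieldNormedType.Exports.
Local Open Scope ring_scope.

(** * Lazy walks and positive definiteness *)

Section Walk.
Variable R : realType.
Implicit Types (F A B : seq R) (g : R -> R) (a u : R) (L : seq (R * R)).

(** The expectation of [g] at [a] plus the lazy walk with steps [F]. Keeping [g] general turns
    concatenation of step lists into composition of operators. *)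
Fixpoint walk F g a : R :=
  if F is u :: F' then
    (walk F' g (a - u) + 2 * walk F' g a + walk F' g (a + u)) / 4
  else g a.

(* The law of [\sum_(u <- F) u * X_u], where the independent [X_u] are [0] with
   probability 1/2 and [1] or [-1] with probability 1/4 each. *)
Definition lw F : R -> R := walk F (fun x => (x == 0)%:R).

(** The law of the signed sum. Half the difference of two independent copies of that sum has law
    [lw F]. *)
Fixpoint sign_walk F a : R :=
  if F is u :: F' then (sign_walk F' (a - u) + sign_walk F' (a + u)) / 2
  else (a == 0)%:R.

Lemma eq_walk F g' g a : g =1 g' -> walk F g a = walk F g' a.
Proof. by move=> e; elim: F a => [|u F IH] a /=; rewrite ?IH. Qed.

Lemma walk_cat A B g a : walk (A ++ B) g a = walk A (walk B g) a.
Proof. by elim: A a => [|u A IH] a //=; rewrite !IH. Qed.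

Lemma lw_cat A B a : lw (A ++ B) a = walk A (lw B) a.
Proof. exact: walk_cat. Qed.

Lemma walkB F g h a : walk F (fun x => g x - h x) a = walk F g a - walk F h a.
Proof. by elim: F a => [|u F IH] a //=; rewrite !IH; field. Qed.

Lemma walk_opp F g a : walk F (fun x => g (- x)) a = walk F g (- a).
Proof.
elim: F a => [|u F IH] a //=; rewrite !IH.
by rewrite !opprD !opprK; field.
Qed.

Lemma walk_step_comm F u g a :
  walk F (fun x => (g (x - u) + 2 * g x + g (x + u)) / 4) a =
  (walk F g (a - u) + 2 * walk F g a + walk F g (a + u)) / 4.
Proof.
elim: F a => [|w F IH] a //=; rewrite !IH.
rewrite (addrAC a (- w) u) (addrAC a (- w) (- u)) (addrAC a w u) (addrAC a w (- u)).
by field.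
Qed.

Lemma walk_comm A B g a : walk A (walk B g) a = walk B (walk A g) a.
Proof.
elim: A g a => [|u A IH] g a //=.
rewrite !IH -walk_step_comm; exact: eq_walk.
Qed.

(** Step operators commute, and exchanges of adjacent blocks generate all permutations. *)
Lemma lw_perm F G a : perm_eq F G -> lw F a = lw G a.
Proof.
move=> FG; apply/esym; move: F G FG.
have H s1 s2 s3 : lw (s1 ++ s2 ++ s3) a = lw (s2 ++ s1 ++ s3) a.
  rewrite !lw_cat (eq_walk s1 (g' := walk s2 (lw s3))); last exact: lw_cat.
  rewrite (eq_walk s2 (g' := walk s1 (lw s3))); last exact: lw_cat.
  exact: walk_comm.
move=> F G FG; pose P s := lw s a = lw F a.
by apply: (catCA_perm_ind (P := P) _ FG) => // s1 s2 s3; rewrite /P H.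
Qed.

Lemma walk_ge0 F g a : (forall x, 0 <= g x) -> 0 <= walk F g a.
Proof.
move=> g0; elim: F a => [|u F IH] a //=.
by rewrite divr_ge0 // !addr_ge0 // mulr_ge0.
Qed.

Lemma lw_ge0 F a : 0 <= lw F a.
Proof. exact: walk_ge0. Qed.

Lemma lwN F a : lw F (- a) = lw F a.
Proof. by rewrite /lw -walk_opp; apply: eq_walk => x; rewrite oppr_eq0. Qed.

Lemma walk_mono F g h a : (forall x, g x <= h x) -> walk F g a <= walk F h a.
Proof.
move=> gh; rewrite -subr_ge0 -walkB.
by apply: walk_ge0 => x; rewrite subr_ge0.
Qed.

Lemma walk_cst F c a : walk F (fun=> c) a = c.
Proof. by elim: F a => [|u F IH] a //=; rewrite !IH; field. Qed.

Definition qform (f : R -> R) L : R :=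
  \sum_(z <- L) \sum_(z' <- L) z.1 * z'.1 * f (z.2 - z'.2).

(** After grouping by location, the right side is the sum of the squared masses of all atoms of [L];
    the left side is the term of the atom at [0]. *)
Lemma qform_diag_ge L :
  (\sum_(z <- L) z.1 * (z.2 == 0)%:R) ^+ 2 <=
  \sum_(z <- L) \sum_(z' <- L) z.1 * z'.1 * (z.2 - z'.2 == 0)%:R.
Proof.
pose Y := undup (map snd L).
have E : \sum_(z <- L) \sum_(z' <- L) z.1 * z'.1 * (z.2 - z'.2 == 0)%:R =
    \sum_(y <- Y) (\sum_(z <- L) z.1 * (z.2 == y)%:R) ^+ 2.
  under [RHS]eq_bigr => y _ do
    (rewrite expr2 mulr_suml; under eq_bigr => z _ do rewrite mulr_sumr).
  rewrite [RHS]exchange_big [LHS]big_seq [RHS]big_seq; apply: eq_bigr => z zL.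
  rewrite [RHS]exchange_big [LHS]big_seq [RHS]big_seq; apply: eq_bigr => z' z'L.
  rewrite (bigD1_seq z.2) ?undup_uniq //=; last first.
    by rewrite mem_undup; apply: map_f.
  rewrite big1 => [|y]; last by rewrite eq_sym => /negbTE->; rewrite mulr0 mul0r.
  by rewrite eqxx subr_eq0 eq_sym mulr1 addr0 mulrA.
rewrite E; have [zY|zY] := boolP (0 \in Y).
  rewrite [leRHS](bigD1_seq 0) ?undup_uniq //= lerDl.
  by apply: sumr_ge0 => y _; rewrite sqr_ge0.
rewrite big_seq big1 => [|z zL]; last first.
  have [z0|] := eqVneq z.2 0; last by rewrite mulr0.
  by case/negP: zY; rewrite mem_undup -z0; apply: map_f.
by rewrite expr0n; apply: sumr_ge0 => y _; rewrite sqr_ge0.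
Qed.

(* [L] is a finitely supported signed measure; the induction moves one step
   of the walk from the kernels into [L]. *)
Lemma sign_walk_qform F L :
  (\sum_(z <- L) z.1 * sign_walk F z.2) ^+ 2 <=
  qform (fun a => lw F (a / 2)) L.
Proof.
elim: F L => [|u F IH] L.
  apply: (le_trans (qform_diag_ge L)); rewrite le_eqVlt; apply/orP; left.
  apply/eqP; apply: eq_bigr => z _; apply: eq_bigr => z' _ /=.
  by rewrite /lw /= mulf_eq0 invr_eq0 pnatr_eq0 orbF.
pose L' := [seq (z.1 / 2, z.2 - u) | z <- L] ++ [seq (z.1 / 2, z.2 + u) | z <- L].
have := IH L'; rewrite /qform !big_cat !big_map /= => H.
apply: le_trans (le_trans H _); rewrite le_eqVlt; apply/orP; left; apply/eqP.
  rewrite -big_split /=; congr (_ ^+ 2); apply: eq_bigr => z _; by field.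
rewrite -big_split /=; apply: eq_bigr => z _.
rewrite !big_cat !big_map /= -!big_split /=; apply: eq_bigr => z' _.
rewrite /lw /= -/(lw F).
(* Two signs differ by [-2], [0] or [2]; halving the argument turns this difference into one lazy
   step. *)
have -> : (z.2 - u - (z'.2 - u)) / 2 = (z.2 - z'.2) / 2 by field.
have -> : (z.2 - u - (z'.2 + u)) / 2 = (z.2 - z'.2) / 2 - u by field.
have -> : (z.2 + u - (z'.2 - u)) / 2 = (z.2 - z'.2) / 2 + u by field.
have -> : (z.2 + u - (z'.2 + u)) / 2 = (z.2 - z'.2) / 2 by field.
by field.
Qed.

Lemma sign_walk_le F a : sign_walk F a ^+ 2 <= lw F 0.
Proof.
have := sign_walk_qform F [:: (1, a)].
by rewrite /qform !big_seq1 /= subrr mul0r !mul1r.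
Qed.

(** The square in [sign_walk_qform] is nonnegative, and doubling the locations undoes the halving
    there. *)
Lemma lw_posdef F L : 0 <= qform (lw F) L.
Proof.
have := sign_walk_qform F [seq (z.1, 2 * z.2) | z <- L].
move=> /(le_trans (sqr_ge0 _)); rewrite /qform big_map.
under eq_bigr => z _ do rewrite big_map.
rewrite (eq_bigr (fun z => \sum_(z' <- L) z.1 * z'.1 * lw F (z.2 - z'.2))) //.
move=> z _; apply: eq_bigr => z' _ /=; congr (_ * lw F _); by field.
Qed.

(** Positive definiteness tested on the unit mass at [0] minus the unit mass at [a]. *)
Lemma lw_le0 F a : lw F a <= lw F 0.
Proof.
have := lw_posdef F [:: (1, 0); (-1, a)].
rewrite /qform !big_cons !big_nil /= !subrr subr0 sub0r lwN; lra.
Qed.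

Lemma lw_drop A B : lw (A ++ B) 0 <= lw B 0.
Proof.
rewrite lw_cat -[leRHS](walk_cst A _ 0); apply: walk_mono => x; exact: lw_le0.
Qed.

(** The law of the walk as a list of pairs (weight, location), the form in which [qform] takes
    measures; locations may repeat. *)
Fixpoint step_law A : seq (R * R) :=
  if A is u :: A' then
    [seq (z.1 / 4, z.2 - u) | z <- step_law A'] ++
    [seq (z.1 / 2, z.2) | z <- step_law A'] ++
    [seq (z.1 / 4, z.2 + u) | z <- step_law A']
  else [:: (1, 0)].

Lemma walk_law A g a : walk A g a = \sum_(z <- step_law A) z.1 * g (a + z.2).
Proof.
elim: A a => [|u A IH] a /=; first by rewrite big_seq1 mul1r addr0.
rewrite !IH !big_cat !big_map /=.
set S1 := (X in X + _ + _); set S2 := (X in _ + 2 * X + _).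
set S3 := (X in _ + _ + X).
have -> : (S1 + 2 * S2 + S3) / 4 = S1 / 4 + (S2 / 2 + S3 / 4) by field.
congr (_ + (_ + _)); rewrite mulr_suml; apply: eq_bigr => z _; rewrite mulrAC //.
  by rewrite addrA addrAC.
by rewrite addrA addrAC.
Qed.

Lemma walk_lawN A g a : walk A g a = \sum_(z <- step_law A) z.1 * g (a - z.2).
Proof.
have -> : walk A g a = walk A (fun x => g (- x)) (- a) by rewrite walk_opp opprK.
rewrite walk_law; apply: eq_bigr => z _; by rewrite opprD opprK.
Qed.

(* Positive definiteness applied to the difference of the laws of the walks
   along [A] and [B]. *)
Lemma lw_exchange U A B :
  2 * lw (U ++ A ++ B) 0 <= lw (U ++ A ++ A) 0 + lw (U ++ B ++ B) 0.
Proof.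
pose L := step_law A ++ [seq (- z.1, z.2) | z <- step_law B].
have E1 g : \sum_(z <- L) z.1 * g z.2 = walk A g 0 - walk B g 0.
  rewrite big_cat big_map /= !walk_law -sumrN; congr (_ + _).
    by apply: eq_bigr => z _; rewrite add0r.
  by apply: eq_bigr => z _; rewrite add0r mulNr.
have E2 g a : \sum_(z <- L) z.1 * g (a - z.2) = walk A g a - walk B g a.
  rewrite big_cat big_map /= !walk_lawN -sumrN; congr (_ + _).
  by apply: eq_bigr => z _; rewrite mulNr.
have := lw_posdef U L; rewrite /qform.
have -> : \sum_(z <- L) \sum_(z' <- L) z.1 * z'.1 * lw U (z.2 - z'.2) =
   \sum_(z <- L) z.1 * (walk A (lw U) z.2 - walk B (lw U) z.2).
  apply: eq_bigr => z _; rewrite -E2 mulr_sumr.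
  by apply: eq_bigr => z' _; rewrite mulrA.
rewrite (E1 (fun x => walk A (lw U) x - walk B (lw U) x)) !walkB.
have C X Y : lw (U ++ X ++ Y) 0 = walk X (walk Y (lw U)) 0.
  rewrite -(@lw_perm ((X ++ Y) ++ U)) ?lw_cat ?walk_cat //.
  by rewrite perm_catC.
rewrite !C (walk_comm B A); lra.
Qed.

(** * Replacing entries by copies of one of them *)

Definition rep (T : Type) (v : T -> R) q (X : seq T) : seq R :=
  flatten [seq nseq q (v x) | x <- X].

Lemma rep_cat (T : Type) (v : T -> R) q X Y :
  rep v q (X ++ Y) = rep v q X ++ rep v q Y.
Proof. by rewrite /rep map_cat flatten_cat. Qed.

Lemma rep1 (T : Type) (v : T -> R) X : rep v 1 X = map v X.
Proof. by elim: X => //= x X IH; rewrite /rep /= -/(rep v 1 X) IH. Qed.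

Lemma rep_double (T : Type) (v : T -> R) q X :
  perm_eq (rep v q X ++ rep v q X) (rep v (q + q) X).
Proof.
elim: X => //= x X IH; rewrite /rep /= -!/(rep v _ X) nseqD.
by rewrite -!catA perm_cat2l perm_catCA perm_cat2l.
Qed.

(** By [lw_exchange], one of the two halves of [L], with all multiplicities doubled, does at least
    as well as [L]. Iterating [t] times leaves a single entry with multiplicity [q * 2^t]. *)
Lemma lw_holder (T : eqType) (v : T -> R) t q U (L : seq T) :
  size L = (2 ^ t)%N -> exists2 x, x \in L &
    lw (U ++ rep v q L) 0 <= lw (U ++ nseq (q * 2 ^ t) (v x)) 0.
Proof.
elim: t q L => [|t IH] q L sL.
  case: L sL => [|x [|]] //= _; exists x; first exact: mem_head.
  by rewrite muln1 /rep /= cats0.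
pose B1 := take (2 ^ t) L; pose B2 := drop (2 ^ t) L.
have s1 : size B1 = (2 ^ t)%N.
  by rewrite size_take sL expnS; case: ltnP => //; lia.
have s2 : size B2 = (2 ^ t)%N by rewrite size_drop sL expnS; lia.
have [x1 x1B h1] := IH (q + q)%N B1 s1; have [x2 x2B h2] := IH (q + q)%N B2 s2.
have Eq : (q * 2 ^ t.+1 = (q + q) * 2 ^ t)%N by rewrite expnS; lia.
have D (X : seq T) : lw (U ++ rep v q X ++ rep v q X) 0 = lw (U ++ rep v (q + q) X) 0.
  by apply: lw_perm; rewrite perm_cat2l rep_double.
have := lw_exchange U (rep v q B1) (rep v q B2).
rewrite !D -rep_cat cat_take_drop Eq => h.
have [h12|h12] := leP (lw (U ++ rep v (q + q) B1) 0) (lw (U ++ rep v (q + q) B2) 0).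
  by exists x2; [exact: mem_drop x2B | lra].
by exists x1; [exact: mem_take x1B | lra].
Qed.

End Walk.

(** * Separated sets under the binomial law *)

Lemma central_bin_rec k :
  (k.+1 * 'C(k.+1.*2, k.+1) = (k.*2.+1).*2 * 'C(k.*2, k))%N.
Proof.
have h1 := mul_bin_diag k.+1.*2 k.
have h2 := mul_bin_down k.*2.+1 k.
rewrite doubleS /= in h1 h2 *.
have E : (k.*2.+1 - k = k.+1)%N by lia.
rewrite E in h2.
rewrite -h1; nia.
Qed.

Lemma central_bin_le k : ('C(k.*2, k) ^ 2 * k.*2.+1 <= 16 ^ k)%N.
Proof.
elim: k => [//|k IH].
have h := central_bin_rec k.
rewrite (expnS 16) -(@leq_pmul2l (k.+1 ^ 2)) ?expn_gt0 //.
set c := 'C(_, _) in IH; set d := 'C(_, _) in h *; set p := (16 ^ k)%N in IH *.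
have -> : (k.+1 ^ 2 * (d ^ 2 * k.+1.*2.+1) = (k.+1 * d) ^ 2 * k.+1.*2.+1)%N.
  by rewrite expnMn mulnA.
rewrite h expnMn.
have -> : ((k.*2.+1).*2 ^ 2 * c ^ 2 * k.+1.*2.+1 =
   (c ^ 2 * k.*2.+1) * (4 * (k.*2.+1) * k.+1.*2.+1))%N.
  by rewrite -!muln2; ring.
apply: (leq_trans (leq_mul IH (leqnn _))).
have -> : (k.+1 ^ 2 * (16 * p) = p * (k.+1 ^ 2 * 16))%N by ring.
rewrite leq_mul2l; apply/orP; right.
by rewrite -!muln2; nia.
Qed.

Lemma bin_le_central N j : ('C(N, j) <= 'C(N, N./2))%N.
Proof.
have inc i : (i.*2.+1 <= N)%N -> ('C(N, i) <= 'C(N, i.+1))%N.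
  move=> iN; rewrite -(@leq_pmul2l i.+1) // mul_bin_left leq_mul2r.
  by apply/orP; right; lia.
have low d : (d <= N./2)%N -> ('C(N, N./2 - d) <= 'C(N, N./2))%N.
  elim: d => [|d IH] dN; first by rewrite subn0.
  apply: leq_trans (IH (ltnW dN)).
  have -> : (N./2 - d = (N./2 - d.+1).+1)%N by lia.
  by apply: inc; lia.
have [jN|jN] := leqP j N./2.
  by have := low (N./2 - j)%N; rewrite subKn //; apply; lia.
have [jN'|jN'] := leqP j N; last by rewrite bin_small.
rewrite -bin_sub //.
by have := low (N./2 - (N - j))%N; rewrite subKn; [apply; lia|lia].
Qed.

(** Even [N] is the central case; odd [N] follows since the central coefficient of order [2k+2] is
    twice that of order [2k+1]. *)
Lemma bin_sq_le N j : ('C(N, j) ^ 2 * N.+1 <= 4 ^ N)%N.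
Proof.
apply: (@leq_trans ('C(N, N./2) ^ 2 * N.+1)).
  by rewrite leq_mul2r leq_exp2r // bin_le_central orbT.
have E4 k : (4 ^ k.*2 = 16 ^ k)%N by rewrite -muln2 mulnC expnM.
suff H (b : bool) k : ('C(b + k.*2, k) ^ 2 * (b + k.*2).+1 <= 4 ^ (b + k.*2))%N.
  by have := H (odd N) N./2; rewrite odd_double_half.
case: b; last by rewrite add0n E4 central_bin_le.
rewrite add1n (expnS 4) E4.
have h1 := mul_bin_diag k.+1.*2 k.
have h := central_bin_le k.+1.
rewrite doubleS /= (expnS 16) in h1 h *.
set c := 'C(k.*2.+1, _) in h1 *; set d := 'C(_, _) in h1 h; set p := (16 ^ k)%N in h *.
have E : (d = 2 * c)%N by nia.
rewrite E in h; nia.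
Qed.

(** * Loss of concentration when atoms are separated *)

Section Gain.
Variable R : realType.
Implicit Types (F : seq R) (g : R -> R) (a u : R).

Lemma sum_binS N (G : nat -> R) :
  \sum_(j < N.+2) 'C(N.+1, j)%:R * G j =
  \sum_(j < N.+1) 'C(N, j)%:R * (G j + G j.+1).
Proof.
under [RHS]eq_bigr => j _ do rewrite mulrDr.
rewrite big_split /= big_ord_recl [X in _ = X + _]big_ord_recl.
rewrite !bin0 -!addrA; congr (_ + _).
rewrite (eq_bigr (fun j : 'I_N.+1 =>
  'C(N, j.+1)%:R * G j.+1 + 'C(N, j)%:R * G j.+1)) => [|j _]; last first.
  by rewrite lift0 binS natrD mulrDl.
rewrite big_split /=; congr (_ + _).
by rewrite big_ord_recr /= bin_small // mul0r addr0.
Qed.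

(* A [q]-separated set has mass at most [q^(-1/2)] under the binomial law:
   conditioning on all but [q - 1] of the steps leaves at most one atom. *)
Lemma separated_binomial (q N : nat) (Z : pred nat) :
  (0 < q <= N.+1)%N ->
  (forall i j, (i < j)%N -> Z i -> Z j -> (q <= j - i)%N) ->
  (\sum_(j < N.+1) 'C(N, j)%:R * (Z j)%:R) ^+ 2 * q%:R <= 4 ^+ N :> R.
Proof.
case/andP => q0 qN; have [d ->] : exists d, N = (d + q.-1)%N.
  by exists (N - q.-1)%N; lia.
elim: d Z => [|d IH] Z sepZ.
  (* With [N = q - 1] the range [0..N] contains at most one point of [Z]. *)
  rewrite add0n; have [[j0 Zj0]|noZ] := pselect (exists j : 'I_(q.-1.+1), Z j); last first.
    rewrite big1 ?expr0n ?mul0r ?exprn_ge0 // => j _.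
    have [Zj|] := boolP (Z j); last by rewrite mulr0.
    by case: noZ; exists j.
  rewrite (bigD1 j0) //= Zj0 mulr1 big1 ?addr0 => [|j jj0]; last first.
    have [Zj|] := boolP (Z j); last by rewrite mulr0.
    have lj := ltn_ord j; have lj0 := ltn_ord j0.
    have /orP[h|h] : (j < j0)%N || (j0 < j)%N by rewrite -neq_ltn.
      by have := sepZ _ _ h Zj Zj0; lia.
    by have := sepZ _ _ h Zj0 Zj; lia.
  rewrite -!natrX -natrM ler_nat.
  by rewrite -[X in (_ * X)%N](prednK q0) bin_sq_le.
rewrite addSn (sum_binS _ (fun j => (Z j)%:R)).
under eq_bigr => j _ do rewrite mulrDr.
rewrite big_split /=.
have h1 := IH Z sepZ.
have h2 := IH (fun j => Z j.+1) (fun i j ij Zi Zj => sepZ i.+1 j.+1 ij Zi Zj).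
set X := \sum_(_ < _) _ in h1 *; set Y := \sum_(_ < _) _ in h2 *.
(* The two conditional bounds combine through [(X + Y)^2 <= 2 X^2 + 2 Y^2]. *)
rewrite (exprS 4); have : 0 <= (X - Y) ^+ 2 * q%:R by rewrite mulr_ge0 ?sqr_ge0.
set p := 4 ^+ _ in h1 h2 *; nra.
Qed.

(** A lazy step is half the sum of two independent signs, so [m] equal steps follow the centred
    binomial law with [2m] trials. *)
Lemma walk_nseq m u g a :
  walk (nseq m u) g a =
  (\sum_(j < (2 * m).+1) 'C(2 * m, j)%:R * g (a + (j%:R - m%:R) * u)) / 4 ^+ m.
Proof.
elim: m a => [|m IH] a /=.
  by rewrite muln0 big_ord_recl big_ord0 /= subrr mul0r !addr0 mul1r divr1.
rewrite !IH.
have -> : (2 * m.+1 = (2 * m).+2)%N by lia.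
rewrite (sum_binS _ (fun j => g (a + (j%:R - m.+1%:R) * u))).
rewrite (sum_binS (2 * m) (fun j => g (a + (j%:R - m.+1%:R) * u) +
   g (a + (j.+1%:R - m.+1%:R) * u))).
rewrite exprS; set p := 4 ^+ m.
have p0 : p != 0 by rewrite expf_neq0 // pnatr_eq0.
set S1 := (X in X / p + _ + _); set S2 := (X in _ + 2 * (X / p) + _).
set S3 := (X in _ + _ + X / p).
set S := (X in _ = X / _).
suff -> : S = S1 + 2 * S2 + S3 by field.
rewrite /S /S1 /S2 /S3 mulr_sumr -!big_split /=; apply: eq_bigr => j _.
have -> : a + (j%:R - m.+1%:R) * u = a - u + (j%:R - m%:R) * u.
  by rewrite -natr1; ring.
have -> : a + (j.+1%:R - m.+1%:R) * u = a + (j%:R - m%:R) * u.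
  by rewrite -!natr1; ring.
have -> : a + (j.+2%:R - m.+1%:R) * u = a + u + (j%:R - m%:R) * u.
  by rewrite -!natr1; ring.
ring.
Qed.

(** The multiples of [u] that are atoms of [lw F] are [q]-separated, so the binomial law gives them
    mass at most [q^(-1/2)], and each atom weighs at most [lw F 0]. *)
Lemma lw_gain F m u q :
  (0 < q <= (2 * m).+1)%N ->
  (forall a (X : nat), (0 < X <= 2 * m)%N ->
     lw F a != 0 -> lw F (a + X%:R * u) != 0 -> (q <= X)%N) ->
  lw (nseq m u ++ F) 0 ^+ 2 * q%:R <= lw F 0 ^+ 2.
Proof.
move=> qm sep.
(* The cut at [2 * m] keeps all differences within the range of the separation hypothesis. *)
pose Z j := (lw F ((j%:R - m%:R) * u) != 0) && (j <= 2 * m)%N.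
have sepZ i j : (i < j)%N -> Z i -> Z j -> (q <= j - i)%N.
  move=> ij /andP[Zi _] /andP[Zj jm]; apply: sep Zi _; first by lia.
  by rewrite natrB ?(ltnW ij) // -mulrDl addrC addrA subrK.
have h := separated_binomial qm sepZ.
rewrite lw_cat walk_nseq.
set S := (X in (X / _) ^+ 2); set S' := \sum_(_ < _) _ in h.
have S0 : 0 <= S by apply: sumr_ge0 => j _; rewrite mulr_ge0 ?lw_ge0.
have SS' : S <= S' * lw F 0.
  rewrite mulr_suml; apply: ler_sum => j _; rewrite -mulrA ler_wpM2l // add0r.
  rewrite /Z -ltnS ltn_ord andbT.
  by case: eqP => [->|_]; rewrite ?mul0r // mul1r lw_le0.
have p0 : 0 < 4 ^+ m :> R by rewrite exprn_gt0.
rewrite expr_div_n mulrAC ler_pdivrMr ?exprn_gt0 //.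
have E : (4 ^+ m) ^+ 2 = 4 ^+ (2 * m) :> R by rewrite -exprM mulnC.
rewrite E; apply: (@le_trans _ _ ((S' * lw F 0) ^+ 2 * q%:R)).
  by rewrite ler_wpM2r // ler_pXn2r // nnegrE // (le_trans S0).
by rewrite exprMn mulrAC mulrC ler_wpM2l ?sqr_ge0.
Qed.

Lemma walk_nseq_neq0 m u g a : walk (nseq m u) g a != 0 ->
  exists2 t : int, (`|t| <= m)%N & g (a - t%:~R * u) != 0.
Proof.
elim: m a => [|m IH] a /=; first by exists 0; rewrite // mul0r subr0.
move=> h.
have : [|| walk (nseq m u) g (a - u) != 0, walk (nseq m u) g a != 0 |
   walk (nseq m u) g (a + u) != 0].
  apply: contraNT h; rewrite !negb_or !negbK => /and3P[/eqP-> /eqP-> /eqP->].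
  by rewrite mulr0 !addr0 mul0r.
case/or3P => /IH[t tm gt].
- exists (t + 1); first by lia.
  by move: gt; congr (g _ != 0); rewrite intrD; ring.
- by exists t => //; lia.
- exists (t - 1); first by lia.
  by move: gt; congr (g _ != 0); rewrite intrB; ring.
Qed.

Lemma lw_rep_neq0 (T : eqType) (v : T -> R) m (X : seq T) a : uniq X ->
  lw (rep v m X) a != 0 ->
  exists2 c : T -> int, (forall y, `|c y| <= m)%N &
    a = \sum_(y <- X) (c y)%:~R * v y.
Proof.
elim: X a => [|x X IH] a /=.
  move=> _; rewrite /lw /=; case: (eqVneq a 0) => [-> _|_]; last by rewrite eqxx.
  by exists (fun=> 0) => //; rewrite big_nil.
case/andP=> xX uX; rewrite /rep /= -/(rep v m X) lw_cat.
case/walk_nseq_neq0=> t tm /(IH _ uX)[c cm E].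
exists (fun y => if y == x then t else c y) => [y|]; first by case: eqP.
rewrite big_cons eqxx -[LHS](subrK (t%:~R * v x)) E addrC; congr (_ + _).
rewrite [LHS]big_seq [RHS]big_seq; apply: eq_bigr => y yX.
by case: eqP => // yx; rewrite yx (negbTE xX) in yX.
Qed.

(** Atoms of the walk are integer combinations with coefficients at most [m]. In this way a failure
    of separation becomes a linear relation. *)
Lemma lw_rep_diff (T : eqType) (v : T -> R) m (X : seq T) a b : uniq X ->
  lw (rep v m X) a != 0 -> lw (rep v m X) (a + b) != 0 ->
  exists2 c : T -> int, (forall y, `|c y| <= 2 * m)%N &
    b = \sum_(y <- X) (c y)%:~R * v y.
Proof.
move=> uX /(lw_rep_neq0 uX)[c cm ac] /(lw_rep_neq0 uX)[c' cm' ac'].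
exists (fun y => c' y - c y) => [y|]; first by have := cm y; have := cm' y; lia.
under eq_bigr => y _ do rewrite intrB mulrBl.
by rewrite sumrB -ac' -ac addrC addKr.
Qed.

End Gain.

(** * Frames and common denominators *)

Lemma absz_leD (a b : int) : (`|(a + b)%R| <= `|a| + `|b|)%N.
Proof. lia. Qed.

Lemma absz_sum_le (I : eqType) (s : seq I) (F : I -> int) B :
  (forall i, i \in s -> `|F i| <= B)%N ->
  (`|(\sum_(i <- s) F i)%R| <= size s * B)%N.
Proof.
elim: s => [|i s IH] FB; first by rewrite big_nil.
rewrite big_cons mulSn; apply: leq_trans (absz_leD _ _) _.
rewrite leq_add ?FB ?mem_head // IH // => j js.
by rewrite FB // in_cons js orbT.
Qed.

(** The left side bounds the height of the relation [z] in [common_denominator]. *)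
Lemma height_arith H m k N : (0 < H)%N -> (0 < m)%N ->
  (H * (2 * m * k + 2 * N * (k * H)) + 2 * m * k * H <=
   6 * N.+1 * m * k * H ^ 2)%N.
Proof.
move=> H0 m0.
have -> : (6 * N.+1 * m * k * H ^ 2 =
    6 * (m * k) * H ^ 2 + 6 * (m * (N * k * H ^ 2)))%N by ring.
have -> : (H * (2 * m * k + 2 * N * (k * H)) + 2 * m * k * H =
   4 * (m * k) * H + 2 * (N * k * H ^ 2))%N by ring.
apply: leq_add.
  by apply: leq_mul; [rewrite leq_mul | rewrite -mulnn leq_pmull].
by apply: leq_mul; rewrite ?leq_pmull.
Qed.

Section Structure.
Variables (R : realType) (T : eqType) (v : T -> R).
Implicit Types (U V W X : seq T) (x y : T).

Definition comb W (q B : nat) x : Prop :=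
  exists2 c : T -> int, (forall y, `|c y| <= B)%N &
    q%:R * v x = \sum_(y <- W) (c y)%:~R * v y.

Definition low_height W (H : nat) x : Prop :=
  exists2 q, (0 < q <= H)%N & comb W q H x.

(** Independence only against relations of bounded height: enough to identify two representations
    over [W] with small coefficients. *)
Definition indep W (G : nat) : Prop :=
  forall c : T -> int, (forall y, `|c y| <= G)%N ->
    \sum_(y <- W) (c y)%:~R * v y = 0 -> forall y, y \in W -> c y = 0.

Lemma comb_mull W q B x k : comb W q B x -> comb W (k * q) (k * B) x.
Proof.
case=> c cB E; exists (fun y => k%:Z * c y) => [y|].
  by rewrite abszM leq_mul2l cB orbT.
rewrite natrM -mulrA E mulr_sumr; apply: eq_bigr => y _.
by rewrite intrM mulrA.
Qed.

(** [lw_holder] applied to [2^t] of the entries of [U] satisfying [P]: they leave [U], and one of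
    them returns with multiplicity [2^t]. *)
Lemma lw_select t (P : pred T) U X : uniq U -> (2 ^ t <= count P U)%N ->
  exists x U', [/\ x \in U /\ P x, x \notin U', subseq U' U,
    size U = (2 ^ t + size U')%N &
    lw (map v U ++ rep v (2 ^ t) X) 0 <=
    lw (map v U' ++ rep v (2 ^ t) (x :: X)) 0].
Proof.
move=> uU Pt; pose B := take (2 ^ t) [seq y <- U | P y].
have sB : size B = (2 ^ t)%N by rewrite size_takel // size_filter.
pose U' := [seq y <- U | y \notin B].
have BU y : y \in B -> P y /\ y \in U.
  by move/mem_take; rewrite mem_filter => /andP.
have pU : perm_eq U (B ++ U').
  have uB : uniq B by rewrite take_uniq // filter_uniq.
  apply: uniq_perm => // [|y].
    rewrite cat_uniq uB filter_uniq // andbT /=; apply/hasPn => y.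
    by rewrite mem_filter => /andP[].
  rewrite mem_cat mem_filter; case: (boolP (y \in B)) => //= yB.
  by case: (BU _ yB).
have [x xB le] := lw_holder v 1 (map v U' ++ rep v (2 ^ t) X) sB.
have [Px xU] := BU _ xB.
exists x, U'; split => //; first by rewrite mem_filter xB.
- exact: filter_subseq.
- by rewrite (perm_size pU) size_cat sB.
have -> : lw (map v U ++ rep v (2 ^ t) X) 0 =
    lw ((map v U' ++ rep v (2 ^ t) X) ++ rep v 1 B) 0.
  apply: lw_perm; rewrite rep1 -catA.
  apply: (@perm_trans _ ((map v U' ++ map v B) ++ rep v (2 ^ t) X)).
    by rewrite perm_cat2r -map_cat perm_map // (perm_trans pU) // perm_catC.
  by rewrite -catA perm_cat2l perm_catC.
apply: (le_trans le); rewrite mul1n le_eqVlt; apply/orP; left; apply/eqP.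
apply: lw_perm; rewrite -catA perm_cat2l perm_catC.
by rewrite [rep v _ (x :: X)]/rep /= perm_refl.
Qed.

(* The frame [W] of the first phase: the candidate [x] is added when it is not
   a rational combination of height [Hs r] of the [r] previous elements, and
   then [lw] drops by a factor [(2m+1)^(1/2)], [m = 2^t]. *)
Lemma independent_frame t (M D : nat) (Hs : nat -> nat) V :
  uniq V ->
  (forall r, 2 * 2 ^ t <= Hs r)%N -> (forall r, Hs r.+1 <= Hs r)%N ->
  1 <= lw (map v V) 0 ^+ 2 * M%:R ->
  (M < (2 * 2 ^ t).+1 ^ D.+1)%N ->
  exists W U,
    [/\ (size W <= D)%N, uniq (W ++ U),
        size V = (size U + size W * 2 ^ t)%N,
        lw (map v V) 0 <= lw (map v U ++ rep v (2 ^ t) W) 0 &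
        (forall r, size W = r.+1 -> indep W (Hs r)) /\
        (count (fun x => ~~ `[< low_height W (Hs (size W)) x >]) U < 2 ^ t)%N].
Proof.
move=> uV Hm Hdec VM MD; set m := (2 ^ t)%N in Hm MD *.
(* [f] counts the additions still possible. At [f = 0] the accumulated factor [(2m+1)^(D+1)] exceeds
   [M], against the assumed size of [lw]. *)
suff claim f W U : (size W + f = D.+1)%N -> uniq (W ++ U) ->
    size V = (size U + size W * m)%N ->
    lw (map v V) 0 <= lw (map v U ++ rep v m W) 0 ->
    lw (rep v m W) 0 ^+ 2 * ((2 * m).+1 ^ size W)%:R <= 1 ->
    (forall r, size W = r.+1 -> indep W (Hs r)) ->
  exists W U,
    [/\ (size W <= D)%N, uniq (W ++ U),
        size V = (size U + size W * m)%N,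
        lw (map v V) 0 <= lw (map v U ++ rep v m W) 0 &
        (forall r, size W = r.+1 -> indep W (Hs r)) /\
        (count (fun x => ~~ `[< low_height W (Hs (size W)) x >]) U < m)%N].
  apply: (claim D.+1 [::] V) => //; rewrite ?addn0 ?mul0n //.
  - by rewrite /rep /= cats0.
  - by rewrite /lw /= eqxx expn0 expr1n mulr1.
elim: f W U => [|f IH] W U sW uWU sV leV gW iW.
  have l0 : lw (map v V) 0 <= lw (rep v m W) 0.
    by apply: le_trans leV _; exact: lw_drop.
  have : lw (map v V) 0 ^+ 2 * M%:R < 1.
    rewrite addn0 in sW; rewrite sW in gW.
    apply: lt_le_trans gW.
    have l1 : lw (map v V) 0 ^+ 2 <= lw (rep v m W) 0 ^+ 2.
      by rewrite ler_pXn2r // nnegrE lw_ge0.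
    have lpos : 0 < lw (map v V) 0 ^+ 2.
      rewrite lt_neqAle sqr_ge0 andbT eq_sym; apply/negP => /eqP E.
      by move: VM; rewrite E mul0r ler10.
    apply: (@lt_le_trans _ _ (lw (map v V) 0 ^+ 2 * ((2 * m).+1 ^ D.+1)%:R)).
      by rewrite ltr_pM2l // ltr_nat.
    by rewrite ler_wpM2r.
  by rewrite ltNge VM.
have [lt_m|ge_m] := ltnP (count
    (fun x => ~~ `[< low_height W (Hs (size W)) x >]) U) m.
  by exists W, U; split => //; lia.
have uU : uniq U by move: uWU; rewrite cat_uniq => /and3P[].
have [x [U' [[xU /= /asboolPn bad] xU' sub sU le]]] := lw_select W uU ge_m.
rewrite -/m in sU le.
have xW : x \notin W.
  by move: uWU; rewrite cat_uniq => /and3P[_ /hasPn/(_ _ xU)].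
have uW : uniq W by move: uWU; rewrite cat_uniq => /and3P[].
apply: (IH (x :: W) U') => /=.
- by rewrite addSnnS.
- rewrite mem_cat negb_or xW xU' /= cat_uniq uW (subseq_uniq sub) // andbT /=.
  apply/hasPn => y /(mem_subseq sub) yU.
  by move: uWU; rewrite cat_uniq => /and3P[_ /hasPn/(_ _ yU)].
- by rewrite sV sU mulSn addnCA addnA.
- exact: le_trans leV le.
(* Two atoms at distance [X * v x] with [0 < X <= 2m] would make [x] of low height; so the gain is
   the full [2m + 1]. *)
- have := @lw_gain _ (rep v m W) m (v x) (2 * m).+1 _ _.
  rewrite [rep v m (x :: W)]/rep /= -/(rep v m W) leqnn => /(_ isT) h.
  rewrite expnS natrM mulrA.
  apply: (le_trans _ gW); apply: ler_wpM2r => //; apply: h => a X X0 na nX.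
  have [c cm E] := lw_rep_diff uW na nX.
  case: bad; exists X; first by case/andP: X0 => -> /= X0; exact: leq_trans X0 (Hm _).
  by exists c => // y; exact: leq_trans (cm y) (Hm _).
(* A relation involving [x] can be solved for [x] with denominator [|c x|], against [bad]. Otherwise
   it is a relation on [W], which is independent up to a height at least as large since [Hs]
   decreases. *)
- move=> _ [<-] c cH; rewrite big_cons => E.
  have cx : c x = 0.
    apply/eqP; case: eqP => // /eqP cx; case: bad.
    exists `|c x|%N; first by rewrite absz_gt0 cx cH.
    exists (fun y => - sgz (c x) * c y) => [y|].
      by rewrite abszM abszN absz_sg cx mul1n.
    move/eqP: E; rewrite addr_eq0 => /eqP E.
    have -> : (`|c x|%N)%:R = (sgz (c x))%:~R * (c x)%:~R :> R.
      by rewrite -intrM -abszEsg.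
    rewrite -mulrA E mulrN -mulNr mulr_sumr; apply: eq_bigr => y _.
    by rewrite intrM mulrA rmorphN.
  move=> y; rewrite inE => /orP[/eqP->//|yW].
  rewrite cx mul0r add0r in E.
  have [r sr] : exists r, size W = r.+1.
    by case: (W) yW => // a W0 _; exists (size W0).
  apply: (iW _ sr) yW => // z; apply: leq_trans (cH z) _.
  by rewrite sr; exact: Hdec.
Qed.

(** While [2^t] entries of low height lack the denominator [k], one of them is absorbed into [Us]
    and [k] becomes [q * k] with [q] minimal. Minimality separates the atoms, so [lw^2] falls by the
    factor [min(q, 2m+1)]. The product [Km] of these factors cannot exceed [M], whence
    [k <= M^g]. *)
Lemma common_denominator t (M H g G N : nat) W U0 (l : R) :
  (0 < g)%N -> (H <= (2 * 2 ^ t).+1 ^ g)%N ->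
  0 <= l -> 1 <= l ^+ 2 * M%:R ->
  (size U0 <= N)%N ->
  indep W G ->
  (6 * N.+1 * 2 ^ t * M ^ g * H ^ 2 <= G)%N ->
  uniq (W ++ U0) ->
  l <= lw (map v U0 ++ rep v (2 ^ t) W) 0 ->
  exists s k U, [/\ (0 < k <= M ^ g)%N, (2 ^ s <= M)%N, subseq U U0,
    size U0 = (size U + s * 2 ^ t)%N &
    (count (fun x => `[< low_height W H x >] && ~~ `[< comb W k (k * H) x >])
       U < 2 ^ t)%N].
Proof.
move=> g0 Hg l0 lM U0N iW HG uW0 lU0; set m := (2 ^ t)%N in Hg HG *.
have m0 : (0 < m)%N by rewrite expn_gt0.
have uW : uniq W by move: uW0; rewrite cat_uniq => /and3P[].
have KleM X Km : l <= lw (rep v m X) 0 -> lw (rep v m X) 0 ^+ 2 * Km%:R <= 1 ->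
    (Km <= M)%N.
  move=> lX gX; have l2 : 0 < l ^+ 2.
    rewrite lt_neqAle sqr_ge0 andbT eq_sym; apply/negP => /eqP E.
    by move: lM; rewrite E mul0r ler10.
  rewrite -(ler_nat R) -(ler_pM2l l2); apply: le_trans lM; apply: le_trans gX.
  by apply: ler_wpM2r => //; rewrite ler_pXn2r // nnegrE (le_trans l0).
have done_now (Us : seq T) k Km U : (Km <= M)%N -> subseq U U0 ->
    size U0 = (size U + size Us * m)%N -> (0 < k <= Km ^ g)%N -> 
    (2 ^ size Us <= Km)%N ->
    (count (fun x => `[< low_height W H x >] && ~~ `[< comb W k (k * H) x >])
       U < m)%N ->
  exists s k U, [/\ (0 < k <= M ^ g)%N, (2 ^ s <= M)%N, subseq U U0,
    size U0 = (size U + s * m)%N &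
    (count (fun x => `[< low_height W H x >] && ~~ `[< comb W k (k * H) x >])
       U < m)%N].
  move=> KM sub sU /andP[k0 kK] sK cU; exists (size Us), k, U; split => //.
    by rewrite k0 (leq_trans kK) // leq_exp2r.
  exact: leq_trans sK KM.
suff claim f Us k Km U : (size U <= f)%N -> uniq ((Us ++ W) ++ U) ->
    subseq U U0 -> size U0 = (size U + size Us * m)%N ->
    l <= lw (map v U ++ rep v m (Us ++ W)) 0 ->
    lw (rep v m (Us ++ W)) 0 ^+ 2 * Km%:R <= 1 ->
    (0 < k <= Km ^ g)%N -> (2 ^ size Us <= Km)%N ->
    (forall u, u \in Us -> comb W k (k * H) u) ->
  exists s k U, [/\ (0 < k <= M ^ g)%N, (2 ^ s <= M)%N, subseq U U0,
    size U0 = (size U + s * m)%N &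
    (count (fun x => `[< low_height W H x >] && ~~ `[< comb W k (k * H) x >])
       U < m)%N].
  apply: (claim (size U0) [::] 1%N 1%N U0) => //; rewrite ?addn0 ?mul0n //.
  - rewrite mulr1 expr_le1 // ?lw_ge0 //.
    by have := lw_drop (rep v m ([::] ++ W)) [::]; rewrite cats0 [X in _ <= X]/lw /= eqxx.
  - by rewrite exp1n.
elim: f Us k Km U => [|f IH] Us k Km U sf uU sub sU lU gU kK sK cU.
  apply: (done_now Us k Km U) => //.
    by apply: (KleM (Us ++ W)) gU; apply: le_trans lU _; exact: lw_drop.
  by move: sf; rewrite leqn0 => /eqP/size0nil ->.
have lW : l <= lw (rep v m (Us ++ W)) 0 by apply: le_trans lU _; exact: lw_drop.
have KM := KleM _ _ lW gU.
have [lt_m|ge_m] := ltnP (count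
    (fun x => `[< low_height W H x >] && ~~ `[< comb W k (k * H) x >]) U) m.
  exact: (done_now Us k Km U).
case/andP: (kK) => k0 kg.
have kM : (k <= M ^ g)%N by apply: leq_trans kg _; rewrite leq_exp2r.
have uU' : uniq U by move: uU; rewrite cat_uniq => /and3P[].
have [x [U' [[xU /= /andP[/asboolP low /asboolPn notG]] xU' sub' sU' le]]] :=
  lw_select (Us ++ W) uU' ge_m.
rewrite -/m in sU' le.
have uX : uniq (Us ++ W) by move: uU; rewrite cat_uniq => /and3P[].
have xX : x \notin Us ++ W.
  by move: uU; rewrite cat_uniq => /and3P[_ /hasPn/(_ _ xU)].
(* Multiplying [k] by the denominator of [x] given by low height works, so a least multiplier exists
   and is at most [H]. *)
have exq : exists j, (0 < j)%N && `[< comb W (j * k) (j * k * H) x >].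
  case: low => q /andP[q0 qH] [p pH E]; exists q; rewrite q0 /=; apply/asboolP.
  exists (fun y => k%:Z * p y) => [y|].
    rewrite abszM; apply: (@leq_trans (k * H)); first by rewrite leq_mul2l pH orbT.
    by rewrite leq_mul2r leq_pmull // orbT.
  rewrite natrM mulrAC E mulr_suml; apply: eq_bigr => y _.
  by rewrite intrM mulrC mulrA.
case: (ex_minnP exq) => q /andP[q0 /asboolP qG] qmin.
have q1 : (1 < q)%N.
  case: q q0 qG {qmin} => [//|[|//]] _; rewrite mul1n => ?; by case: notG.
have qH : (q <= H)%N.
  case: low => q' /andP[q'0 q'H] [p pH E]; apply: leq_trans q'H.
  apply: qmin; rewrite q'0 /=; apply/asboolP.
  exists (fun y => k%:Z * p y) => [y|].
    rewrite abszM; apply: (@leq_trans (k * H)); first by rewrite leq_mul2l pH orbT.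
    by rewrite leq_mul2r leq_pmull // orbT.
  rewrite natrM mulrAC E mulr_suml; apply: eq_bigr => y _.
  by rewrite intrM mulrC mulrA.
(* The [m] copies of [v x] detect differences only up to [2m], which caps the gain. Since
   [q <= H <= (2m+1)^g], still [q <= q'^g]. *)
pose q' := minn q (2 * m).+1.
have q'1 : (1 < q')%N by rewrite /q' leq_min q1 ltnS muln_gt0.
have sep a (X : nat) : (0 < X <= 2 * m)%N -> lw (rep v m (Us ++ W)) a != 0 ->
    lw (rep v m (Us ++ W)) (a + X%:R * v x) != 0 -> (q' <= X)%N.
  case/andP=> X0 Xm na nX; rewrite geq_min; apply/orP; left; apply: qmin.
  rewrite X0 /=; apply/asboolP.
  have [c cm E] := lw_rep_diff uX na nX.
  have [d dP] : exists d : T -> T -> int, forall u, u \in Us ->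
      (forall y, `|d u y| <= k * H)%N /\
      k%:R * v u = \sum_(y <- W) (d u y)%:~R * v y.
    have : forall u, exists e : T -> int, u \in Us ->
        (forall y, `|e y| <= k * H)%N /\
        k%:R * v u = \sum_(y <- W) (e y)%:~R * v y.
      move=> u; have [uUs|] := boolP (u \in Us); last by exists (fun=> 0).
      by have [e eB eE] := cU _ uUs; exists e.
    by move/choice => [d dP]; exists d.
  pose C y := k%:Z * c y + \sum_(u <- Us) c u * d u y.
  have EC : (X * k)%:R * v x = \sum_(y <- W) (C y)%:~R * v y.
    rewrite mulnC natrM -mulrA E big_cat mulrDr addrC /=.
    under [RHS]eq_bigr => y _ do rewrite intrD mulrDl.
    rewrite big_split /=; congr (_ + _).
      by rewrite mulr_sumr; apply: eq_bigr => y _; rewrite intrM mulrA.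
    rewrite [RHS](eq_bigr (fun y =>
        \sum_(u <- Us) (c u)%:~R * ((d u y)%:~R * v y))) => [|y _]; last first.
      rewrite rmorph_sum mulr_suml; apply: eq_bigr => u _.
      by rewrite rmorphM mulrA.
    rewrite [RHS]exchange_big mulr_sumr [LHS]big_seq [RHS]big_seq; apply: eq_bigr => u uUs.
    by have [_ eE] := dP _ uUs; rewrite -mulr_sumr -eE mulrCA.
  have Cb y : (`|C y| <= 2 * m * k + size Us * (2 * m * (k * H)))%N.
    apply: leq_trans (absz_leD _ _) _; rewrite abszM mulnC leq_add ?leq_mul //.
    apply: absz_sum_le => u uUs; rewrite abszM leq_mul //.
    by case: (dP _ uUs).
  case: low => p0 /andP[p00 p0H] [p pH Ep].
  have H0 : (0 < H)%N := leq_trans p00 p0H.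
  (* [C] represents [X * k * v x] over [W], but its crude bound grows with [Us]. Comparison with the
     representation of low height gives the relation [z]; independence kills it, and the bound on
     [C] improves to [X * k * H]. *)
  pose z y := p0%:Z * C y - (X * k)%:Z * p y.
  have zB y : (`|z y| <= G)%N.
    apply: leq_trans (absz_leD _ _) _; rewrite abszN !abszM !absz_nat.
    have h1 : (p0 * `|C y| <= H * (2 * m * k + size Us * (2 * m * (k * H))))%N.
      exact: leq_mul.
    have h2 : (X * k * `|p y| <= 2 * m * k * H)%N by rewrite leq_mul ?leq_mul.
    have h3 : (size Us * (2 * m * (k * H)) <= 2 * N * (k * H))%N.
      rewrite mulnA (mulnCA (size Us)) leq_mul2r; apply/orP; right.
      by rewrite leq_mul2l /=; apply: leq_trans U0N; rewrite sU leq_addl.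
    apply: leq_trans (leq_add h1 h2) _.
    apply: (@leq_trans (6 * N.+1 * m * k * H ^ 2)); last first.
      apply: leq_trans HG; rewrite -!mulnA leq_mul2l /=.
      by rewrite !leq_mul2l leq_mul2r kM !orbT.
    apply: (@leq_trans (H * (2 * m * k + 2 * N * (k * H)) + 2 * m * k * H)).
      by rewrite leq_add2r leq_mul2l leq_add2l h3 orbT.
    exact: height_arith.
  have z0 y : y \in W -> z y = 0.
    apply: iW => //; under eq_bigr => w _ do rewrite intrB mulrBl !intrM -!mulrA.
    by rewrite sumrB -!mulr_sumr -EC -Ep mulrCA subrr.
  (* Independence controls [C] on [W] only, so [C] is cut off elsewhere. *)
  exists (fun y => if y \in W then C y else 0) => [y|].
    case: ifP => // /z0 /eqP; rewrite subr_eq0 => /eqP E2.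
    apply: (@leq_trans (p0 * `|C y|)); first by rewrite leq_pmull.
    have := congr1 absz E2; rewrite !abszM => ->.
    by rewrite leq_mul2l pH orbT.
  rewrite EC [LHS]big_seq [RHS]big_seq; apply: eq_bigr => y yW; by rewrite yW.
apply: (IH (x :: Us) (q * k)%N (q' * Km)%N U') => //=.
- by rewrite -ltnS; apply: leq_trans sf; rewrite sU' -[X in (X < _)%N]add0n ltn_add2r.
- rewrite mem_cat negb_or xX xU' /= cat_uniq uX (subseq_uniq sub') // andbT /=.
  apply/hasPn => y /(mem_subseq sub') yU.
  by move: uU; rewrite cat_uniq => /and3P[_ /hasPn/(_ _ yU)].
- exact: subseq_trans sub' sub.
- by rewrite sU sU' mulSn addnCA addnA.
- exact: le_trans lU le.
- have q'm : (0 < q' <= (2 * m).+1)%N by rewrite geq_minr (ltnW q'1).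
  have h := lw_gain q'm sep.
  rewrite natrM mulrA; apply: (le_trans _ gU); exact: ler_wpM2r.
- rewrite muln_gt0 q0 k0 /= expnMn leq_mul // /q'.
  case: (leqP q (2 * m).+1) => _ //; last exact: leq_trans qH Hg.
  by rewrite -{1}(expn1 q) leq_pexp2l.
- by rewrite expnS leq_mul.
- move=> u; rewrite inE -mulnA => /orP[/eqP->|uUs]; first by rewrite mulnA.
  by apply: comb_mull; exact: cU.
Qed.

End Structure.

Lemma expn_le_exp2 x d : (x ^ d <= d ^ d * 2 ^ x)%N.
Proof.
have [->|d0] := posnP d; first by rewrite !expn0 mul1n expn_gt0.
have h : (x <= d * 2 ^ (x %/ d))%N.
  rewrite {1}(divn_eq x d); apply: (@leq_trans (d * (x %/ d).+1)).
    by rewrite mulnS mulnC addnC leq_add2r ltnW // ltn_mod.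
  by rewrite leq_mul2l ltn_expl ?orbT.
apply: (@leq_trans ((d * 2 ^ (x %/ d)) ^ d)); first by rewrite leq_exp2r.
by rewrite expnMn -expnM leq_mul2l leq_pexp2l ?leq_trunc_div ?orbT.
Qed.

(** [s] is at most logarithmic in [n]. The proof compares powers of exponent [d * (A + 1)], so that
    the factor [2^s] is absorbed by [n^A]. *)
Lemma polylog_le a d A : exists n0, forall n s,
  (n0 <= n)%N -> (2 ^ s <= n ^ A)%N -> ((a + s) ^ d <= n)%N.
Proof.
pose d' := (d * A.+1)%N; exists (d' ^ d' * 2 ^ a)%N => n s n0 sA.
rewrite -(@leq_exp2r _ _ A.+1) // -expnM.
apply: leq_trans (expn_le_exp2 _ _) _.
by rewrite expnD mulnA (expnS n); apply: leq_mul.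
Qed.

(** * Coefficients of a concentrated linear form *)

Section Linear.
Variable R : realType.

(** With [m] of order [n^(1/(2e))], at most [m * (D + 2 + s)] entries are lost: [m] for each frame
    element and each of the [s] denominator steps, and fewer than [m] in each of the two exceptional
    sets. *)
Lemma linear_structure (A e : nat) : (0 < e)%N ->
  exists K D n0, forall (T : finType) (v : T -> R),
    (n0 <= #|T|)%N ->
    1 <= lw (map v (enum T)) 0 ^+ 2 * (#|T| ^ A)%:R ->
  exists (w : {ffun 'I_D -> T}) (k : nat) (E : {set T}),
    [/\ (0 < k <= #|T| ^ K)%N, (#|~: E| ^ e <= #|T|)%N &
      forall x, x \in E -> exists2 c : 'I_D -> int,
        (forall h, `|c h| <= #|T| ^ K)%N &
        k%:R * v x = \sum_h (c h)%:~R * v (w h)].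
Proof.
move=> e0; pose e2 := (2 * e)%N; pose D := (e2 * A)%N.
(* A frame that stops at height [n^h] must be independent up to height [n^(F h)] for the second
   phase. The stopping size is not known in advance, so the exponents [hs] descend from [hs 0] to
   [2]. *)
pose F h := (A * (e2 * h) + 2 * h + 4)%N.
pose hs r := iter (D - r) F 2.
have hs_mono r : (hs r.+1 <= hs r)%N.
  rewrite /hs; case: (ltnP r D) => rD; last by have /eqP-> : (D - r == D - r.+1)%N; lia.
  have -> : (D - r = (D - r.+1).+1)%N by lia.
  by rewrite iterS {2}/F; lia.
have hs2 r : (2 <= hs r)%N.
  by rewrite /hs; case: (D - r)%N => //= i; rewrite /F addn4.
have hs0 r : (hs r <= hs 0)%N.
  by elim: r => // r IH; exact: leq_trans (hs_mono r) IH.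
pose K := (A * (e2 * hs 0) + hs 0)%N.
have [n1 n1P] := polylog_le (D + 2) e2 A.
exists K, D, (n1 + 6)%N => T v; set n := #|T| => n0 lv.
have n6 : (6 <= n)%N by lia.
have e20 : (0 < e2)%N by rewrite /e2 muln_gt0.
pose t := trunc_log (2 ^ e2) n; pose m := (2 ^ t)%N.
have /andP[tn nt] : ((2 ^ e2) ^ t <= n < (2 ^ e2) ^ t.+1)%N.
  by apply: trunc_log_bounds; [rewrite -{1}(expn0 2) ltn_exp2l | lia].
have mn : (m ^ e2 <= n)%N by rewrite /m -expnM mulnC expnM.
have nm : (n < (2 * m).+1 ^ e2)%N.
  apply: (leq_trans nt); rewrite -expnM mulnC expnM leq_exp2r //.
  by rewrite expnS leqW.
have m_le : (m <= n)%N.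
  by apply: leq_trans mn; rewrite -{1}(expn1 m) leq_pexp2l // expn_gt0.
have nD : (n ^ A < (2 * m).+1 ^ D.+1)%N.
  apply: (@leq_ltn_trans ((2 * m).+1 ^ D)).
    rewrite /D expnM; case: (posnP A) => [->//|A0].
    by rewrite leq_exp2r // ltnW.
  by rewrite ltn_exp2l // ltnS muln_gt0 expn_gt0.
have pow2 i j : (i <= j)%N -> (n ^ i <= n ^ j)%N.
  by move=> ij; rewrite leq_pexp2l //; lia.
have Hm r : (2 * m <= n ^ hs r)%N.
  apply: (@leq_trans (n ^ 2)); last exact: pow2.
  by rewrite -mulnn leq_mul //; lia.
have [W [U [sW uWU sT leU [iW badU]]]] :=
  independent_frame (Hs := fun r => (n ^ hs r)%N) (enum_uniq T) Hm
    (fun r => pow2 _ _ (hs_mono r)) lv nD.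
rewrite -/m in sT leU badU; rewrite -cardE -/n in sT.
pose r := size W; pose h := hs r; pose g := (e2 * h)%N.
pose G := (n ^ F h)%N.
have iG : indep v W G.
  case rE : r => [|r']; first by move/size0nil: rE => ->.
  have := iW _ rE; congr (indep v W (n ^ _)).
  have rD : (r' < D)%N by rewrite -rE.
  rewrite /hs /h /hs rE; have -> : (D - r' = (D - r'.+1).+1)%N by lia.
  by rewrite iterS.
have h0 : (0 < h)%N by apply: leq_trans (hs2 r).
have g0 : (0 < g)%N by rewrite muln_gt0 e20.
have Hg : (n ^ h <= (2 * m).+1 ^ g)%N by rewrite /g expnM leq_exp2r // ltnW.
have GP : (6 * n.+1 * m * (n ^ A) ^ g * (n ^ h) ^ 2 <= G)%N.
  rewrite -!expnM /G /F -/g (mulnC h 2) expnD [X in (_ <= X)%N]mulnC expnD.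
  rewrite mulnA; apply: leq_mul => //; apply: leq_mul => //.
  apply: (@leq_trans (6 * n.+1 * n)); first by rewrite leq_mul.
  have -> : (n ^ 4 = n * n * n * n)%N by ring.
  rewrite leq_mul2r; apply/orP; right.
  apply: (@leq_trans (n * n.+1)); first by rewrite leq_mul2r n6 orbT.
  by rewrite -mulnA leq_mul2l; apply/orP; right; nia.
have Un : (size U <= n)%N by rewrite sT leq_addr.
have [s [k [U1 [kM sA sub sU1 badU1]]]] :=
  common_denominator g0 Hg (lw_ge0 _ _) lv Un iG GP uWU leU.
rewrite -/m in sU1 badU1.
pose E := [set x in U1 | `[< comb v W k (k * n ^ h) x >]].
have T0 : T.
  by case: (pickP (mem T)) => [x _ //|/eq_card0]; rewrite -/n; lia.
exists [ffun i : 'I_D => nth T0 W i], k, E; split.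
- case/andP: kM => -> /leq_trans-> //; rewrite -expnM; apply: pow2.
  by rewrite /K /g; apply: leq_trans (leq_addr _ _); rewrite !leq_mul2l hs0 !orbT.
- have uU : uniq U by move: uWU; rewrite cat_uniq => /and3P[].
  have uU1 := subseq_uniq sub uU.
  have cE : (#|~: E| <= m * (D + 2 + s))%N.
    have := cardsC E; rewrite -/n sT sU1.
    have -> : #|E| = count (fun x => `[< comb v W k (k * n ^ h) x >]) U1.
      rewrite -size_filter -(card_uniqP (filter_uniq _ uU1)) -cardsE.
      by apply: eq_card => x; rewrite !inE mem_filter andbC.
    set P := fun x => `[< comb _ _ _ _ _ >].
    have := count_predC P U1.
    have : (count (predC P) U1 <= m + m)%N.
      set L := fun x => `[< low_height v W (n ^ h) x >].
      apply: (@leq_trans (count (fun x => ~~ L x) U1 +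
        count (fun x => L x && ~~ P x) U1)).
        by rewrite -count_predUI (leq_trans _ (leq_addr _ _)) // sub_count // => x /=; case: (L x).
      by rewrite leq_add // ltnW // (leq_ltn_trans (leq_count_subseq _ sub)).
    have : (size W * m <= D * m)%N by rewrite leq_mul2r sW orbT.
    have -> : (m * (D + 2 + s) = D * m + (m + m) + s * m)%N by ring.
    move: (count P U1) (count (predC P) U1) (size W * m)%N (D * m)%N (s * m)%N.
    by clear; lia.
  (* After squaring, both [m] and [D + 2 + s] have their power [2e] bounded by [n]. *)
  rewrite -(@leq_exp2r _ _ 2) // -expnM mulnC -/e2.
  apply: (@leq_trans ((m * (D + 2 + s)) ^ e2)); first by rewrite leq_exp2r.
  rewrite expnMn -mulnn leq_mul //; apply: n1P => //; lia.
- move=> x; rewrite inE => /andP[_ /asboolP[c cB ->]].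
  (* Slots of [w] beyond [size W] hold the default [T0] and get coefficient [0]. *)
  exists (fun i => if (i < size W)%N then c (nth T0 W i) else 0) => [i|].
    case: ifP => // _; apply: leq_trans (cB _) _.
    apply: (@leq_trans ((n ^ A) ^ g * n ^ h)).
      by rewrite leq_mul2r; case/andP: kM => _ ->; rewrite orbT.
    rewrite -expnM -expnD; apply: pow2.
    by rewrite /K /g leq_add ?hs0 // !leq_mul2l hs0 !orbT.
  rewrite (big_nth T0) big_mkord.
  rewrite (big_ord_widen D (fun i => (c (nth T0 W i))%:~R * v (nth T0 W i))) //.
  rewrite big_mkcond /=; apply: eq_bigr => i _; rewrite ffunE.
  by case: ifP => // _; rewrite mul0r.
Qed.

End Linear.

(** * Progressions *)

Section Gap.
Local Open Scope classical_set_scope.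
Variable R : realType.

Lemma gap_not_proper r (g : 'I_r -> R) M : ~ gap_proper g (fun=> M) ->
  exists (d : 'I_r -> int) (h0 : 'I_r),
    [/\ (forall h, `|d h| <= 2 * M)%N, d h0 != 0 & \sum_h g h * (d h)%:~R = 0].
Proof.
move=> np; have [m1 [m2 [m1B m2B E ne]]] : exists m1 m2,
    [/\ gap_box (fun=> M) m1, gap_box (fun=> M) m2, gap_val g m1 = gap_val g m2 &
        m1 != m2].
  apply: contrapT => no; apply: np => m1 m2 /set_mem B1 /set_mem B2 E.
  by have [//|ne] := eqVneq m1 m2; case: no; exists m1, m2.
have [h0 dh0] : exists h0, m1 h0 - m2 h0 != 0.
  apply: contrapT => no; case/eqP: ne; apply/ffunP => h.
  have [/eqP|ne] := eqVneq (m1 h - m2 h) 0; first by rewrite subr_eq0 => /eqP.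
  by case: no; exists h.
exists (fun h => m1 h - m2 h), h0; split => // [h|].
  by have := m1B h; have := m2B h; lia.
under eq_bigr => h _ do rewrite intrB mulrBr !mulrzr.
by rewrite sumrB -[X in X - _]/(gap_val g m1) E subrr.
Qed.

(* A relation [\sum_h d h * g h = 0] with [d h0 != 0] makes the generator
   [g h0] redundant once the other ones are divided by [d h0]. *)
Lemma gap_reduce_rank r (g : 'I_r.+1 -> R) M (d : 'I_r.+1 -> int) h0 :
  (forall h, `|d h| <= 2 * M)%N -> d h0 != 0 -> \sum_h g h * (d h)%:~R = 0 ->
  sym_gap g (fun=> M) `<=`
  sym_gap (fun i : 'I_r => g (lift h0 i) / (d h0)%:~R) (fun=> (4 * M ^ 2)%N).
Proof.
move=> dB d0 E _ [m mB <-].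
exists [ffun i => m (lift h0 i) * d h0 - m h0 * d (lift h0 i)].
  move=> i /=; rewrite ffunE.
  have b1 : (`|(m (lift h0 i) * d h0)%R| <= M * (2 * M))%N.
    by rewrite abszM leq_mul // mB.
  have b2 : (`|(m h0 * d (lift h0 i))%R| <= M * (2 * M))%N.
    by rewrite abszM leq_mul // mB.
  have -> : (4 * M ^ 2 = M * (2 * M) + M * (2 * M))%N by ring.
  by move: b1 b2; clear; lia.
rewrite /gap_val [RHS](bigD1_ord h0) //=.
rewrite (bigD1_ord h0) //= in E.
have d0R : (d h0)%:~R != 0 :> R by rewrite intr_eq0.
apply: (mulIf d0R); rewrite mulrDl -[X in _ = X * _ + _]mulrzr.
rewrite (mulrAC (g h0)).
have -> : g h0 * (d h0)%:~R = - \sum_i g (lift h0 i) * (d (lift h0 i))%:~R.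
  by apply/eqP; rewrite -addr_eq0 E.
rewrite mulNr !mulr_suml addrC -sumrB; apply: eq_bigr => i _.
rewrite ffunE -[_ / _ *~ _]mulrzr -[g _ *~ _]mulrzr intrB !intrM.
by field.
Qed.

(** As long as properness fails the rank drops, and at rank [0] every progression is proper. For
    [n >= 4] the new bound [4 n^(2K)] is at most [n^(2K+1)]. *)
Lemma gap_to_proper r K : exists K', forall n (g : 'I_r -> R), (4 <= n)%N ->
  exists r' (g' : 'I_r' -> R) j,
    [/\ (r' <= r)%N, (j <= K')%N, gap_proper g' (fun=> (n ^ j)%N) &
      sym_gap g (fun=> (n ^ K)%N) `<=` sym_gap g' (fun=> (n ^ j)%N)].
Proof.
elim: r K => [|r IH] K.
  exists K => n g n4; exists 0%N, g, K; split=> //.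
  by move=> m1 m2 _ _ _; apply/ffunP; case.
have [K' K'P] := IH (2 * K + 1)%N.
exists (maxn K K') => n g n4.
have [pr|/gap_not_proper[d [h0 [dB d0 E]]]] := pselect (gap_proper g (fun=> (n ^ K)%N)).
  by exists r.+1, g, K; split => //; rewrite leq_maxl.
have [r' [g' [j [r'r jK pr sub]]]] := K'P n
  (fun i : 'I_r => g (lift h0 i) / (d h0)%:~R) n4.
exists r', g', j; split => //; first exact: leqW.
  by rewrite leq_max jK orbT.
apply: subset_trans sub; apply: subset_trans (gap_reduce_rank dB d0 E) _.
move=> _ [m mB <-]; exists m => // h; apply: leq_trans (mB h) _.
by rewrite addn1 (expnS n) leq_mul // mulnC expnM.
Qed.

Lemma card_sym_gap r (g : 'I_r -> R) M :
  (sym_gap g (fun=> M) #<= `I_((2 * M).+1 ^ r))%card.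
Proof.
have -> : ((2 * M).+1 ^ r)%N = #|{ffun 'I_r -> 'I_(2 * M).+1}|.
  by rewrite card_ffun !card_ord.
pose f (i : 'I_#|{ffun 'I_r -> 'I_(2 * M).+1}|) : R :=
  gap_val g [ffun h => (enum_val i h)%:Z - M%:Z].
apply: (@card_le_trans _ _ _ (range f)); last first.
  by rewrite (card_le_eqr card_II); exact: card_image_le.
apply: subset_card_le => _ [m mB <-].
exists (enum_rank [ffun h => inord `|(m h + M%:Z)%R|%N]) => //.
rewrite /f; congr gap_val; apply/ffunP => h; rewrite ffunE enum_rankK ffunE.
have := mB h => /= b; rewrite inordK; move: b; move: (m h) => a b; clear -b; lia.
Qed.

End Gap.

(** * Counting signs *)

Lemma pigeonhole (I K : finType) (S : {set I}) (Q : I -> K -> Prop) :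
  (0 < #|S|)%N -> (forall x, x \in S -> exists k, Q x k) ->
  exists k, (#|S| <= #|K| * #|[set x in S | `[< Q x k >]]|)%N.
Proof.
move=> S0 QS; apply: contrapT => no.
have lt k : (#|K| * #|[set x in S | `[< Q x k >]]| <= #|S|.-1)%N.
  by rewrite -ltnS prednK // ltnNge; apply/negP => h; apply: no; exists k.
have K0 : (0 < #|K|)%N.
  case/card_gt0P: S0 => x /QS[k _]; by apply/card_gt0P; exists k.
have : (#|S| <= \sum_k #|[set x in S | `[< Q x k >]]|)%N.
  rewrite -sum1_card; under [leqRHS]eq_bigr => k _ do rewrite -sum1_card.
  rewrite (exchange_big_dep (mem S)) /=; last by move=> k x _; rewrite inE => /andP[].
  apply: leq_sum => x xS; case: (QS x xS) => k kQ.
  rewrite (bigD1 k) ?leq_addr // inE xS; exact/asboolP.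
move=> le1.
have : (#|K| * \sum_k #|[set x in S | `[< Q x k >]]| <= #|K| * #|S|.-1)%N.
  by rewrite big_distrr -sum_nat_const; apply: leq_sum => k _.
by rewrite leq_pmul2l // => le2; have := leq_trans le1 le2; lia.
Qed.

(** Double counting of the pairs [(i, t)] with [i] outside [E t]: an unpopular [i] is missed by more
    than half of [G]. *)
Lemma popular_elements (I J : finType) (G : {set J}) (E : J -> {set I}) :
  (0 < #|G|)%N -> exists2 t, t \in G &
  (#|~: [set i | #|G| <= 2 * #|[set t in G | i \in E t]|]| <= 2 * #|~: E t|)%N.
Proof.
move=> G0; set P := [set i | _]; apply: contrapT => no.
have lt t : t \in G -> (2 * #|~: E t| <= #|~: P|.-1)%N.
  move=> tG; have : (2 * #|~: E t| < #|~: P|)%N; last by lia.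
  by rewrite ltnNge; apply/negP => h; apply: no; exists t.
have P0 : (0 < #|~: P|)%N.
  case/card_gt0P: G0 => t tG; rewrite lt0n; apply/negP => /eqP E0.
  by apply: no; exists t => //; rewrite E0.
have le1 : (\sum_(t in G) 2 * #|~: E t| <= #|G| * #|~: P|.-1)%N.
  by rewrite -sum_nat_const; apply: leq_sum => t tG; exact: lt.
have le2 : (#|~: P| * #|G| <= \sum_(t in G) 2 * #|~: E t|)%N.
  have -> : (\sum_(t in G) 2 * #|~: E t| =
      \sum_i \sum_(t in G) 2 * (i \notin E t))%N.
    rewrite exchange_big; apply: eq_bigr => t _.
    rewrite -big_distrr -sum1_card big_mkcond /=; congr (_ * _)%N.
    by apply: eq_bigr => i _; rewrite inE; case: (_ \in _).
  rewrite -sum_nat_const [leqLHS]big_mkcond; apply: leq_sum => i _.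
  case: ifP => //; rewrite !inE -ltnNge => h.
  have : (#|[set t in G | i \in E t]| + \sum_(t in G) (i \notin E t) = #|G|)%N.
    rewrite -sum1_card -[RHS]sum1_card.
    rewrite (big_mkcond (fun t => t \in [set _ in _ | _])).
    rewrite !(big_mkcond (fun t => t \in G)) -big_split /=.
    by apply: eq_bigr => t _; rewrite inE; case: (t \in G) => //=; case: (_ \in _).
  by rewrite -big_distrr /=; lia.
by have := leq_trans le2 le1; rewrite mulnC leq_pmul2l //; lia.
Qed.

Section Signs.
Variable R : realType.

Definition sgb (b : bool) : R := if b then 1 else -1.

Lemma sign_walk_ge0 F a : 0 <= sign_walk F a :> R.
Proof. by elim: F a => [|u F IH] a //=; rewrite divr_ge0 // addr_ge0. Qed.

Lemma sign_walk_le1 F a : sign_walk F a <= 1 :> R.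
Proof.
elim: F a => [|u F IH] a /=; first by rewrite lern1 leq_b1.
by rewrite ler_pdivrMr // mul1r lerD.
Qed.

(** [sign_walk_le] costs one squaring and the square of [lw] another, whence the fourth power. *)
Lemma lw_of_sign_walk F a N : 1 <= sign_walk F a * N%:R :> R ->
  1 <= lw F 0 ^+ 2 * (N ^ 4)%N%:R.
Proof.
move=> h; have s0 := sign_walk_ge0 F a.
apply: (@le_trans _ _ ((sign_walk F a * N%:R) ^+ 4)); first exact: exprn_ege1.
rewrite exprMn natrX ler_wpM2r ?exprn_ge0 // (exprM _ 2 2).
by rewrite ler_pXn2r ?nnegrE ?lw_ge0 ?sqr_ge0 // sign_walk_le.
Qed.

(** Flipping the sign at [x] pairs the sign vectors and reproduces the average in [sign_walk]. *)
Lemma sign_walk_count (I : finType) (v : I -> R) (s : seq I) a : uniq s ->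
  \sum_(f : {ffun I -> bool}) (\sum_(i <- s) sgb (f i) * v i == a)%:R =
  2 ^+ #|I| * sign_walk (map v s) a.
Proof.
elim: s a => [|x s IH] a /=.
  move=> _; under eq_bigr => f _ do rewrite big_nil eq_sym.
  by rewrite sumr_const card_ffun card_bool -[LHS]mulr_natr natrX mulrC.
case/andP=> xs us; pose F (f : {ffun I -> bool}) : R :=
  (\sum_(i <- x :: s) sgb (f i) * v i == a)%:R.
rewrite -[LHS]/(\sum_f F f).
pose flip (f : {ffun I -> bool}) := [ffun i => if i == x then ~~ f i else f i].
have flipK : involutive flip.
  by move=> f; apply/ffunP => i; rewrite !ffunE; case: eqP => // _; rewrite negbK.
have E : \sum_f F f + \sum_f F f = 2 ^+ #|I| * sign_walk (map v s) (a - v x) +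
    2 ^+ #|I| * sign_walk (map v s) (a + v x).
  rewrite -!IH // {2}(reindex_inj (inv_inj flipK)) /= -!big_split /=.
  apply: eq_bigr => f _; rewrite /F !big_cons /flip ffunE eqxx.
  have -> : \sum_(i <- s) sgb ([ffun i => if i == x then ~~ f i else f i] i) * v i
      = \sum_(i <- s) sgb (f i) * v i.
    rewrite [LHS]big_seq [RHS]big_seq; apply: eq_bigr => i si; rewrite ffunE.
    by case: eqP => // ix; rewrite -ix si in xs.
  set S := \sum_(i <- s) _.
  have e1 : (1 * v x + S == a) = (S == a - v x).
    by rewrite mul1r addrC [RHS]eq_sym subr_eq eq_sym.
  have e2 : (-1 * v x + S == a) = (S == a + v x).
    by rewrite mulN1r addrC subr_eq.
  by case: (f x); rewrite /sgb /= e1 e2 // addrC.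
have -> : \sum_f F f = (\sum_f F f + \sum_f F f) / 2 by field.
by rewrite E; field.
Qed.

End Signs.

(** * Bilinear forms *)

Lemma leq_exp2rW x y z : (x <= y -> x ^ z <= y ^ z)%N.
Proof. by case: z => // z xy; rewrite leq_exp2r. Qed.

Lemma shift_abszK (z : int) (y : nat) :
  (`|z| <= y)%N -> `|(z + y%:Z)%R|%N%:Z - y%:Z = z.
Proof. lia. Qed.

Lemma shift_absz_lt (z : int) (y : nat) :
  (`|z| <= y)%N -> (`|(z + y%:Z)%R| < (2 * y).+1)%N.
Proof. lia. Qed.

Lemma shift_le (x y : nat) :
  (x < (2 * y).+1)%N -> (`|(x%:Z - y%:Z)%R| <= y)%N.
Proof. lia. Qed.

Section Bilinear.
Variable R : realType.

(** The generators are the frame entries divided by the common denominator; the progression is then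
    made proper. *)
Lemma linear_gap (A e : nat) : (0 < e)%N -> exists K n0, forall n,
  (n0 <= n)%N -> forall b : 'I_n -> R,
  1 <= sign_walk (map b (enum 'I_n)) 0 * (n ^ A)%N%:R ->
  exists r (g : 'I_r -> R) (N : 'I_r -> nat) (E : {set 'I_n}),
    [/\ (r <= K)%N, gap_proper g N, (sym_gap g N #<= `I_(n ^ K))%card,
        (#|~: E| ^ e <= n)%N & forall j, j \in E -> sym_gap g N (b j)].
Proof.
move=> e0; have [K [D [n0 HL]]] := @linear_structure R (A * 4) e e0.
have [K' HK'] := @gap_to_proper R D K.
exists (K'.+1 * D + D)%N, (n0 + 4)%N => n nn b hb.
have := HL 'I_n b; rewrite card_ord => /(_ (leq_trans (leq_addr _ _) nn)).
rewrite expnM => /(_ (lw_of_sign_walk hb))[w [k [E [/andP[k0 kK] cE HE]]]].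
have n4 : (4 <= n)%N by apply: leq_trans nn; rewrite leq_addl.
have [r [g [j [rD jK pr sub]]]] := HK' n (fun h => b (w h) / k%:R) n4.
exists r, g, (fun=> (n ^ j)%N), E; split => //.
- by apply: leq_trans rD _; rewrite leq_addl.
- apply: card_le_trans (card_sym_gap _ _) _; rewrite card_le_II.
  apply: (@leq_trans ((n ^ K'.+1) ^ D)).
    apply: (@leq_trans ((n ^ K'.+1) ^ r)).
      apply: leq_exp2rW; rewrite expnS.
      have : (n ^ j <= n ^ K')%N by rewrite leq_pexp2l //; lia.
      have : (0 < n ^ j)%N by rewrite expn_gt0; lia.
      by move: (n ^ j)%N (n ^ K')%N => x y; nia.
    by rewrite leq_pexp2l // expn_gt0; lia.
  by rewrite -expnM leq_pexp2l ?leq_addr //; lia.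
- move=> i iE; apply: sub; have [c cB Ec] := HE i iE.
  exists [ffun h => c h] => [h|]; first by rewrite ffunE.
  have k0R : k%:R != 0 :> R by rewrite pnatr_eq0 -lt0n.
  rewrite /gap_val; apply: (mulfI k0R); rewrite Ec mulr_sumr.
  apply: eq_bigr => h _; rewrite ffunE -[_ *~ _]mulrzr; field.
  exact: k0R.
Qed.

Definition row_form n (M : 'M[R]_n) (f : {ffun 'I_n -> bool}) (i : 'I_n) : R :=
  \sum_j M i j * sgb R (f j).

(** For many sign vectors [t] the row forms obey relations with one frame [w] and denominator [k],
    and for a popular row also with the same coefficients. Such a relation says that the combined
    row is orthogonal to [t], so this row is concentrated at [0]. *)
Lemma bilinear_rows (A e : nat) : (0 < e)%N -> exists K A' n0, forall n,
  (n0 <= n)%N -> forall (M : 'M[R]_n) (a : R),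
  (2 * 4 ^ n)%N%:R <= (n ^ A)%N%:R *
    \sum_(t : {ffun 'I_n -> bool}) \sum_(s : {ffun 'I_n -> bool})
      (\sum_i sgb R (s i) * row_form M t i == a)%:R :> R ->
  exists (I0 I1 : {set 'I_n}) (k x : nat) (ki : 'I_n -> 'I_n -> int),
    [/\ (#|I0| <= K)%N, (0 < k <= n ^ K)%N, (forall i i0, `|ki i i0| <= n ^ K)%N,
        (x ^ e <= n)%N /\ (#|~: I1| <= 2 * x)%N &
        forall i, i \in I1 ->
          1 <= sign_walk (map (fun j => k%:R * M i j +
            \sum_(i0 in I0) (ki i i0)%:~R * M i0 j) (enum 'I_n)) 0 *
            (n ^ A')%N%:R].
Proof.
move=> e0; have [K [D [n0 HL]]] := @linear_structure R (A * 4) e e0.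
(* The losses in order: good [t], choice of [w] and [k], the factor [2] for popular rows, choice of
   the coefficients. *)
pose A' := (A + (D + K.+1) + 1 + K.+1 * D)%N.
exists (K + D)%N, A', (n0 + 4)%N => n nn M a hyp.
have n0n : (n0 <= n)%N by apply: leq_trans nn; rewrite leq_addr.
have n4 : (4 <= n)%N by apply: leq_trans nn; rewrite leq_addl.
pose sw t := sign_walk (map (row_form M t) (enum 'I_n)) a.
have hyp1 : (2 * 2 ^ n)%N%:R <= (n ^ A)%N%:R * \sum_t sw t.
  have E : \sum_t \sum_(s : {ffun 'I_n -> bool})
      (\sum_i sgb R (s i) * row_form M t i == a)%:R = 2 ^+ n * \sum_t sw t.
    rewrite mulr_sumr; apply: eq_bigr => t _.
    have := sign_walk_count (row_form M t) a (enum_uniq 'I_n).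
    rewrite card_ord => <-; apply: eq_bigr => s _.
    by rewrite big_enum.
  have p0 : 0 < 2 ^+ n :> R by rewrite exprn_gt0.
  rewrite E mulrCA in hyp; rewrite -(ler_pM2l p0); apply: le_trans hyp.
  by rewrite -natrX -natrM ler_nat -[4%N]/(2 * 2)%N expnMn mulnCA.
pose Good := [set t | 1 <= sw t * (n ^ A)%N%:R]%SET.
(* The [t] outside [Good] account for at most [2^n] of the lower bound [2 * 2^n]. *)
have goodP : (2 ^ n <= n ^ A * #|Good|)%N.
  rewrite -(ler_nat R).
  have : (n ^ A)%N%:R * \sum_t sw t <= (n ^ A * #|Good|)%N%:R + (2 ^ n)%N%:R.
    apply: (@le_trans _ _ (\sum_t ((n ^ A)%N%:R * (t \in Good)%:R + 1))).
      rewrite mulr_sumr; apply: ler_sum => t _; rewrite inE mulrC.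
      case: (leP 1) => [h|/ltW h]; last by rewrite mulr0 add0r.
      rewrite mulr1 ler_wpDr // mulrC -[leRHS]mulr1.
      by rewrite ler_wpM2l // sign_walk_le1.
    rewrite big_split /= -mulr_sumr sumr_const card_ffun card_bool card_ord.
    rewrite natrM -natr_sum; suff -> : (\sum_t (t \in Good) = #|Good|)%N by [].
    by rewrite -sum1_card [RHS]big_mkcond; apply: eq_bigr => t _; case: (t \in Good).
  rewrite mulnC muln2 -addnn natrD in hyp1.
  by move=> h; rewrite -(lerD2r (2 ^ n)%N%:R); apply: le_trans h.
have Good0 : (0 < #|Good|)%N.
  rewrite lt0n; apply/negP => /eqP G0.
  by move: goodP; rewrite G0 muln0 leqn0 expn_eq0.
pose Q (t : {ffun 'I_n -> bool}) (q : {ffun 'I_D -> 'I_n} * 'I_(n ^ K).+1) :=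
  (0 < q.2)%N /\ exists E : {set 'I_n}, (#|~: E| ^ e <= n)%N /\
    forall i, i \in E -> exists2 c : 'I_D -> int, (forall h, `|c h| <= n ^ K)%N &
      (q.2 : nat)%:R * row_form M t i = \sum_h (c h)%:~R * row_form M t (q.1 h).
have QP t : t \in Good -> exists q, Q t q.
  rewrite inE => ht; have := HL 'I_n (row_form M t); rewrite card_ord => /(_ n0n).
  rewrite expnM => /(_ (lw_of_sign_walk ht))[w [k [E [/andP[k0 kK] cE HE]]]].
  exists (w, inord k); rewrite /Q /= inordK //; split => //.
  by exists E; split.
have [[w k] cG1] := pigeonhole Good0 QP.
set G1 := [set x in Good | _]%SET in cG1.
have G10 : (0 < #|G1|)%N.
  by rewrite lt0n; apply/negP => /eqP G0; move: cG1; rewrite G0 muln0 leqNgt Good0.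
have k0 : (0 < k)%N.
  by case/card_gt0P: G10 => t; rewrite inE => /andP[_ /asboolP[]].
have [Ef EfP] : exists Ef : {ffun 'I_n -> bool} -> {set 'I_n}, forall t, t \in G1 ->
    (#|~: Ef t| ^ e <= n)%N /\ forall i, i \in Ef t ->
      exists2 c : 'I_D -> int, (forall h, `|c h| <= n ^ K)%N &
      (k : nat)%:R * row_form M t i = \sum_h (c h)%:~R * row_form M t (w h).
  have : forall t, exists E : {set 'I_n}, t \in G1 ->
    (#|~: E| ^ e <= n)%N /\ forall i, i \in E ->
      exists2 c : 'I_D -> int, (forall h, `|c h| <= n ^ K)%N &
      (k : nat)%:R * row_form M t i = \sum_h (c h)%:~R * row_form M t (w h).
    move=> t; have [|_] := boolP (t \in G1); last by exists finset.set0.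
    by rewrite inE => /andP[_ /asboolP[_ [E EP]]]; exists E.
  by move/choice => [Ef EfP]; exists Ef.
(* The exceptional rows vary with [t]; keeping the rows that are regular for half of [G1] at most
   doubles their number. *)
have [t0 t0G cI1] := popular_elements Ef G10.
set I1 := [set i | _]%SET in cI1.
pose Rel (c : 'I_D -> int) i : {set {ffun 'I_n -> bool}} :=
  [set t | (k : nat)%:R * row_form M t i ==
     \sum_h (c h)%:~R * row_form M t (w h)]%SET.
have [cc ccP] : exists cc : 'I_n -> 'I_D -> int, forall i,
    (forall h, `|cc i h| <= n ^ K)%N /\ (i \in I1 ->
    (2 ^ n <= n ^ A' * #|Rel (cc i) i|)%N).
  have : forall i, exists c : 'I_D -> int, 
    (forall h, `|c h| <= n ^ K)%N /\ (i \in I1 ->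
    (2 ^ n <= n ^ A' * #|Rel c i|)%N); last first.
    by move/choice => [cc ccP]; exists cc.
  move=> i; have [iI1|_] := boolP (i \in I1); last by exists (fun=> 0).
  pose S := [set t in G1 | i \in Ef t]%SET.
  have cS : (#|G1| <= 2 * #|S|)%N by move: iI1; rewrite inE.
  have S0 : (0 < #|S|)%N.
    by rewrite lt0n; apply/negP => /eqP G0; move: cS; rewrite G0 muln0 leqNgt G10.
  (* Coefficients are shifted into a finite type so that the pigeonhole principle applies. *)
  pose dec (c : {ffun 'I_D -> 'I_(2 * n ^ K).+1}) h := (c h)%:Z - (n ^ K)%:Z.
  pose Q2 (t : {ffun 'I_n -> bool}) c := (k : nat)%:R * row_form M t i =
     \sum_h (dec c h)%:~R * row_form M t (w h).
  have Q2P t : t \in S -> exists c, Q2 t c.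
    rewrite inE => /andP[tG iE]; have [_ /(_ i iE)[c cB Ec]] := EfP t tG.
    exists [ffun h => inord `|(c h + (n ^ K)%:Z)%R|%N]; rewrite /Q2 Ec.
    apply: eq_bigr => h _; congr (_%:~R * _); rewrite /dec ffunE.
    by rewrite inordK ?(shift_abszK (cB h)) // shift_absz_lt.
  have [c cS2] := pigeonhole S0 Q2P.
  exists (dec c); split => [h|_].
    by rewrite /dec shift_le ?ltn_ord.
  set S2 := [set x in S | _]%SET in cS2.
  have cS3 : (#|S2| <= #|Rel (dec c) i|)%N.
    apply: subset_leq_card; apply/fintype.subsetP => t.
    by rewrite !inE => /andP[_ /asboolP/eqP].
  apply: (@leq_trans (n ^ A' * #|S2|)); last by rewrite leq_mul2l cS3 orbT.
  rewrite card_ffun !card_ord in cS2; rewrite card_prod card_ffun !card_ord in cG1.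
  apply: (leq_trans goodP).
  have -> : (n ^ A' * #|S2| =
      n ^ A * (n ^ D * n ^ K.+1 * (n * ((n ^ K.+1) ^ D * #|S2|))))%N.
    rewrite /A' (expnD n (_ + 1)) (expnD n (_ + _) 1) (expnD n A) (expnD n D) expnM expn1.
    move: (n ^ A)%N (n ^ D)%N ((n ^ K.+1) ^ D)%N (n ^ K.+1)%N #|S2| => *; ring.
  rewrite leq_mul2l; apply/orP; right; apply: (leq_trans cG1).
  have nK : (0 < n ^ K)%N by rewrite expn_gt0; lia.
  apply: leq_mul.
    rewrite leq_mul2l; apply/orP; right; rewrite expnS; move: (n ^ K)%N nK => y.
    by clear -n4; nia.
  apply: (leq_trans cS); apply: leq_mul; first lia.
  apply: (leq_trans cS2); rewrite leq_mul2r; apply/orP; right; apply: leq_exp2rW.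
  by rewrite expnS; move: (n ^ K)%N nK => y; clear -n4; nia.
pose I0 := [set w h | h : 'I_D]%SET.
(* [w] may repeat an index, so coefficients with the same target are added; the bound grows from
   [n^K] to [n^(K+D)]. *)
pose ki i i0 := - \sum_(h | w h == i0) cc i h.
exists I0, I1, k, #|~: Ef t0|, ki; split.
- by apply: leq_trans (leq_imset_card _ _) _; rewrite card_ord leq_addl.
- rewrite k0 /=; apply: (@leq_trans (n ^ K)); first by rewrite -ltnS.
  by rewrite leq_pexp2l ?leq_addr //; lia.
- move=> i i0; rewrite /ki abszN.
  rewrite (_ : \sum_(h | _) _ = \sum_(h <- enum [pred h | w h == i0]) cc i h);
    last by rewrite big_enum.
  apply: leq_trans (absz_sum_le (B := (n ^ K)%N) _) _.
    by move=> h _; have [] := ccP i.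
  rewrite addnC expnD leq_mul2r; apply/orP; right.
  rewrite -cardE; apply: leq_trans (max_card _) _.
  by rewrite card_ord; apply: ltnW; apply: ltn_expl; lia.
- by split => //; have [] := EfP t0 t0G.
- move=> i iI1; have [cB /(_ iI1) cT] := ccP i.
  set b := fun j => _.
  have bE j : b j = k%:R * M i j - \sum_h (cc i h)%:~R * M (w h) j.
    rewrite /b; congr (_ + _).
    rewrite (partition_big w (mem I0)) /=; last by move=> h _; exact: imset_f.
    rewrite -sumrN; apply: eq_bigr => i0 _.
    rewrite /ki rmorphN mulNr rmorph_sum mulr_suml; congr (- _).
    by apply: eq_bigr => h /eqP->.
  have p0 : 0 < 2 ^+ n :> R by rewrite exprn_gt0.
  rewrite -(ler_pM2l p0) mulr1 mulrA.
  have := sign_walk_count b 0 (enum_uniq 'I_n); rewrite card_ord => <-.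
  move: cT; rewrite -(ler_nat R) natrM natrX mulrC => /le_trans; apply.
  rewrite ler_wpM2r // -sum1_card natr_sum big_mkcond /=; apply: ler_sum => t _.
  rewrite inE big_enum /=; case: ifP => // /eqP Et.
  suff -> : \sum_j sgb R (t j) * b j = 0 by rewrite eqxx.
  under eq_bigr => j _ do rewrite bE mulrBr mulrCA mulr_sumr.
  rewrite sumrB -mulr_sumr exchange_big /=.
  move/eqP: Et; rewrite -subr_eq0 => /eqP Et; rewrite -[RHS]Et; congr (_ - _).
    by congr (_ * _); apply: eq_bigr => j _; rewrite mulrC.
  apply: eq_bigr => h _; rewrite mulr_sumr; apply: eq_bigr => j _.
  by rewrite mulrCA (mulrC (sgb _ _)).
Qed.

End Bilinear.

(** * Bernoulli variables *)

Local Open Scope classical_set_scope.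

Section Probability.
Variables (R : realType) (d : measure_display) (T : measurableType d).
Variable P : probability T R.

(** The argument passes to the complement of [E]: the cylinders of sign vectors outside [p] are
    disjoint, avoid [E], and have mass [2^(-|I|)] each. Outcomes with values other than signs thus
    need no separate treatment. *)
Lemma probability_le_signs (I : finType) (X : I -> {RV P >-> R}) (E : set T)
    (p : pred {ffun I -> bool}) :
  (forall i, is_bernoulli (X i)) -> independent_RVs X -> measurable E ->
  (forall (u : {ffun I -> bool}) w, (forall i, X i w = sgb R (u i)) -> E w -> p u) ->
  (P E <= (#|p|%:R / 2 ^+ #|I|)%:E)%E.
Proof.
move=> bX iX mE pE.
pose B (u : {ffun I -> bool}) i : set R := [set sgb R (u i)].
pose cyl u := \bigcap_(i in [set` [set: I]%SET]) (X i @^-1` B u i).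
have mB u i : measurable (X i @^-1` B u i) by apply: measurable_funPTI; exact: measurable_set1.
have mcyl u : measurable (cyl u).
  by apply: fin_bigcap_measurable => // i _; exact: mB.
have cylP u : P (cyl u) = (2 ^- #|I|)%:E.
  rewrite /cyl (iX [set: I]%SET (B u)) => [|i]; last exact: measurable_set1.
  rewrite (eq_bigr (fun=> (2^-1)%:E)) => [|i _]; last first.
    by rewrite /B /sgb; have [b1 b2] := bX i; case: (u i).
  by rewrite prodEFin prodr_const cardsT exprVn.
pose s := enum (predC p).
pose U := \bigcup_(u in [set` s]) cyl u.
have mU : measurable U.
  by apply: fin_bigcup_measurable => // u _; exact: mcyl.
have PU : P U = ((size s)%:R * 2 ^- #|I|)%:E.
  rewrite /U measure_fin_bigcup //.
    rewrite -fsbig_seq ?enum_uniq // (eq_bigr (fun=> (2 ^- #|I|)%:E)) => [|u _].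
      by rewrite sumEFin big_const_seq count_predT iter_addr addr0 mulr_natl.
    exact: cylP.
  move=> u u' _ _ [w [cu cu']]; apply/ffunP => i.
  have := cu i; have := cu' i; rewrite /B /= inE => /(_ isT) -> /(_ isT).
  rewrite /sgb; case: (u i) (u' i) => [] [] // /eqP.
    by rewrite eq_sym -subr_eq0 opprK (_ : 1 + 1 = 2%:R) // pnatr_eq0.
  by rewrite -subr_eq0 opprK (_ : 1 + 1 = 2%:R) // pnatr_eq0.
have UE : (P U <= P (~` E))%E.
  apply: le_measure; rewrite ?inE //; first exact: measurableC.
  move=> w [u] /= us cu Ew; move: us; rewrite mem_enum => /negP; apply.
  by apply: pE Ew => i; have := cu i; rewrite /= inE => /(_ isT).
have sz : (size s)%:R = 2 ^+ #|I| - #|p|%:R :> R.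
  rewrite -cardE; apply/eqP; rewrite eq_sym subr_eq addrC -natrD cardC.
  by rewrite card_ffun card_bool natrX.
move: UE; rewrite PU probability_setC // sz.
rewrite -(fineK (fin_num_measure P E mE)) -EFinB !lee_fin mulrBl mulfV ?expf_neq0 //.
lra.
Qed.

End Probability.

(** Halving [r] provides a value [a] of probability above [r / 2] whether or not the supremum is
    attained; that probability is then bounded by a count of sign vectors. *)
Lemma rho_b_counting (R : realType) (d : measure_display) (T : measurableType d)
    (P : probability T R) (n : nat) (x y : 'I_n -> {RV P >-> R}) (M : 'M[R]_n)
    (r : R) :
  (forall i, is_bernoulli (x i)) -> (forall j, is_bernoulli (y j)) ->
  independent_RVs (join_family x y) ->
  0 < r -> (r%:E <= rho_b x y M)%E ->
  exists a, r / 2 * 4 ^+ n <=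
    \sum_(t : {ffun 'I_n -> bool}) \sum_(s : {ffun 'I_n -> bool})
      (\sum_i sgb R (s i) * row_form M t i == a)%:R.
Proof.
move=> bx by_ ind r0 hr.
have [a ha] : exists a, ((r / 2)%:E <
    P [set w : T | (\sum_i \sum_j M i j * x i w * y j w = a)%R])%E.
  apply: contrapT => no; move: hr; rewrite leNgt => /negP; apply.
  apply: (@le_lt_trans _ _ (r / 2)%:E); last by rewrite lte_fin; lra.
  apply: ge_ereal_sup => _ [a _ <-]; rewrite leNgt; apply/negP => h.
  by apply: no; exists a.
exists a; set S := (X in _ <= X).
have mE : measurable [set w : T | \sum_i \sum_j M i j * x i w * y j w = a].
  have mf : measurable_fun setT (fun w => \sum_i \sum_j M i j * x i w * y j w).
    apply: measurable_sum => i; apply: measurable_sum => j.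
    by apply: measurable_realfun.measurable_funM => //; apply: measurable_realfun.measurable_funM.
  by rewrite -[X in measurable X]setTI; apply: (mf measurableT [set a]).
pose p (u : {ffun 'I_n + 'I_n -> bool}) :=
  \sum_i sgb R (u (inl i)) * (\sum_j M i j * sgb R (u (inr j))) == a.
have pS : #|p|%:R = S :> R.
  pose h (q : {ffun 'I_n -> bool} * {ffun 'I_n -> bool})
      : {ffun 'I_n + 'I_n -> bool} :=
    [ffun k : 'I_n + 'I_n => match k with inl i => q.2 i | inr j => q.1 j end].
  pose h' (u : {ffun 'I_n + 'I_n -> bool})
      : {ffun 'I_n -> bool} * {ffun 'I_n -> bool} :=
    ([ffun j => u (inr j)], [ffun i => u (inl i)]).
  have hK : cancel h h'.
    by move=> [t s]; congr pair; apply/ffunP => i; rewrite !ffunE.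
  have h'K : cancel h' h.
    by move=> u; apply/ffunP => -[i|j]; rewrite !ffunE.
  rewrite /S pair_big /= -sum1_card natr_sum big_mkcond /=.
  rewrite (reindex h) /=; last by exists h' => ? _; [exact: hK|exact: h'K].
  apply: eq_bigr => q _.
  rewrite (_ : (h q \in p) = (\sum_i sgb R (q.2 i) * row_form M q.1 i == a)).
    by case: eqP.
  rewrite unfold_in /p; congr (_ == _); apply: eq_bigr => i _; rewrite !ffunE.
  by congr (_ * _); apply: eq_bigr => j _; rewrite ffunE.
have := @probability_le_signs R d T P ('I_n + 'I_n)%type (join_family x y) _ p
  _ ind mE _.
rewrite pS card_sum card_ord => le.
have : ((r / 2)%:E < (S / 2 ^+ (n + n))%:E)%E.
  apply: lt_le_trans ha _; apply: le => [[i|j]|u w uw /= Ew] //=.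
  rewrite /p -Ew.
  apply/eqP; apply: eq_bigr => i _; rewrite mulr_sumr; apply: eq_bigr => j _.
  by rewrite -(uw (inl i)) -(uw (inr j)) /= mulrCA mulrA.
rewrite lte_fin ltr_pdivlMr ?exprn_gt0 // => /ltW.
by rewrite addnn -muln2 mulnC exprM -natrX.
Qed.

(** * Choice of the constants and conclusion *)

Theorem theorem4p8 (R : realType) (C : R) (hC : 0 < C) :
  exists c : R, forall eps : R, 0 < eps < 1 ->
  exists K n0 : nat, forall n : nat, (n0 <= n)%N ->
  forall (d : measure_display) (T : measurableType d) (P : probability T R)
    (x y : 'I_n -> {RV P >-> R}) (A : 'M[R]_n),
  (forall i, is_bernoulli (x i)) ->
  (forall j, is_bernoulli (y j)) ->
  independent_RVs (join_family x y) ->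
  ((n%:R `^ (- C))%:E <= rho_b x y A)%E ->
  exists (I0 J0 I J : {set 'I_n}) (k l : int) (ki : 'I_n -> 'I_n -> int)
    (lj : 'I_n -> 'I_n -> int),
    [/\ (#|I0| <= K)%N /\ (#|J0| <= K)%N,
        n%:R - c * n%:R `^ eps <= #|I|%:R /\ n%:R - c * n%:R `^ eps <= #|J|%:R,
        I :&: I0 = finset.set0 /\ J :&: J0 = finset.set0,
        [/\ k != 0 /\ (`|k| <= n ^ K)%N, l != 0 /\ (`|l| <= n ^ K)%N,
            forall i i0, i \in I -> i0 \in I0 -> (`|ki i i0| <= n ^ K)%N &
            forall j0 j, j0 \in J0 -> j \in J -> (`|lj j0 j| <= n ^ K)%N] &
        forall (i : 'I_n), i \in I -> forall a' : 'I_n -> R,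
          (forall j, j \in J ->
             A i j = a' j / (k%:~R * l%:~R)
                     - (\sum_(i0 in I0) (ki i i0)%:~R * A i0 j) / k%:~R
                     - (\sum_(j0 in J0) (lj j0 j)%:~R * A i j0) / l%:~R) ->
          exists (r : nat) (g : 'I_r -> R) (N : 'I_r -> nat),
            [/\ (r <= K)%N, gap_proper g N, (sym_gap g N #<= `I_(n ^ K))%card &
                #|[pred j in J | a' j \notin sym_gap g N]|%:R
                  <= c * n%:R `^ eps]].
Proof.
(* [2] for the unpopular rows and [1] for the removal of [I0]. *)
exists 3 => eps /andP[eps0 eps1].
have [e e0 e_eps] : exists2 e, (0 < e)%N & 1 <= e%:R * eps.
  exists (Num.truncn eps^-1).+1 => //.
  rewrite -[leLHS](mulVf (lt0r_neq0 eps0)) ler_wpM2r ?(ltW eps0) //.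
  by apply: ltW; apply: real_truncnS_gt; exact: num_real.
(* The extra [1] provides a factor [n >= 4], which pays for the [2] in the counting hypothesis and
   for the halving in [rho_b_counting]. *)
have [A1 A1C] : exists A1 : nat, C + 1 <= A1%:R.
  exists (Num.truncn (C + 1)).+1.
  by apply: ltW; apply: real_truncnS_gt; exact: num_real.
have [K1 [A2 [n1 H1]]] := bilinear_rows R A1 e0.
have [K2 [n2 H2]] := linear_gap R A2 e0.
(* The term [K1^e] ensures [K1 <= n^eps], so that removing [I0] is affordable. *)
exists (maxn K1 K2), (n1 + n2 + K1 ^ e + 4)%N => n nn d T P x y M bx by_ ind rho.
have [n1n n2n Kn n4] : [/\ n1 <= n, n2 <= n, K1 ^ e <= n & 4 <= n]%N.
  by clear -nn; split; lia.
have n0 : (0 < n)%N by apply: leq_trans n4.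
have root z : (z ^ e <= n)%N -> z%:R <= n%:R `^ eps.
  move=> zn; have [->|z0] := posnP z; first exact: powR_ge0.
  have z1 : 1 <= z%:R :> R by rewrite ler1n.
  rewrite -[leLHS]powRr1 //; apply: (le_trans (ler_powR z1 e_eps)).
  rewrite powRrM powR_mulrn //; apply: ge0_ler_powR; rewrite ?nnegrE ?exprn_ge0 //.
    exact: ltW.
  by rewrite -natrX ler_nat.
have npos : 0 < n%:R :> R by rewrite ltr0n.
have [a ha] := rho_b_counting bx by_ ind (powR_gt0 _ npos) rho.
have hyp : (2 * 4 ^ n)%N%:R <= (n ^ A1)%N%:R *
    \sum_(t : {ffun 'I_n -> bool}) \sum_(s : {ffun 'I_n -> bool})
      (\sum_i sgb R (s i) * row_form M t i == a)%:R :> R.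
  move: ha; set S := (X in _ <= X) => ha.
  have big : 4 <= (n ^ A1)%N%:R * n%:R `^ (- C).
    have n1R : 1 <= n%:R :> R by rewrite ler1n.
    apply: (@le_trans _ _ n%:R); first by rewrite ler_nat.
    have n0R := ltW npos.
    have -> : (n ^ A1)%N%:R * n%:R `^ (- C) = n%:R `^ (A1%:R - C).
      by rewrite natrX -powR_mulrn // powRD // (lt0r_neq0 npos) implybT.
    rewrite -[leLHS]powRr1 //; apply: ler_powR => //.
    by move: A1C; lra.
  apply: (@le_trans _ _ ((n ^ A1)%N%:R * (n%:R `^ (- C) / 2 * 4 ^+ n))); last first.
    by rewrite ler_wpM2l.
  rewrite natrM natrX mulrA ler_wpM2r ?exprn_ge0 // mulrA ler_pdivlMr //.
  by apply: le_trans big; lra.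
have [I0 [I1 [k [z [ki [cI0 /andP[k0 kK] kiK [ze cI1] rows]]]]]] :=
  H1 n n1n M a hyp.
have pK i : (i <= maxn K1 K2 -> n ^ i <= n ^ maxn K1 K2)%N.
  by move=> ?; rewrite leq_pexp2l.
exists I0, finset.set0, (I1 :\: I0)%SET, [set: 'I_n]%SET, k%:Z, 1, ki, (fun _ _ => 0).
split.
- by rewrite cards0 leq_max cI0.
- have nI : (n <= #|(I1 :\: I0)%SET| + (2 * z + K1))%N.
    rewrite -[X in (X <= _)%N](card_ord n) -(cardsC (I1 :\: I0)%SET) leq_add2l.
    apply: (@leq_trans #|(~: I1 :|: I0)%SET|).
      apply: subset_leq_card; apply/fintype.subsetP => i; rewrite !inE.
      by case: (i \in I0); case: (i \in I1).
    by apply: leq_trans (leq_card_setU _ _) _; apply: leq_add.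
  have nIR : n%:R <= #|(I1 :\: I0)%SET|%:R + (2 * z%:R + K1%:R) :> R.
    by rewrite -natrM -!natrD ler_nat.
  have zR := root _ ze; have KR : K1%:R <= n%:R `^ eps by apply: root.
  have p0 : 0 <= n%:R `^ eps := powR_ge0 _ _.
  split; first by lra.
  by rewrite cardsT card_ord; lra.
- split; first by apply/setP => i; rewrite !inE; case: (i \in I0); rewrite ?andbF.
  by rewrite finset.setI0.
- split => //.
  + rewrite -lt0n; split => //; apply: leq_trans kK _; apply: pK; exact: leq_maxl.
  + by split => //; rewrite absz1 expn_gt0 n0.
  + by move=> i i0 _ _; apply: leq_trans (kiK _ _) _; apply: pK; exact: leq_maxl.
- move=> i; rewrite finset.in_setD => /andP[_ iI1] a' Ha'.
  (* With [J0] empty, [l = 1] and all columns in [J], the defining equation determines [a']: it is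
     the combined row already known to be concentrated. *)
  have a'E j : a' j = k%:R * M i j + \sum_(i0 in I0) (ki i i0)%:~R * M i0 j.
    have kR : k%:R != 0 :> R by rewrite pnatr_eq0 -lt0n.
    rewrite Ha' ?in_setT // big_set0 mul0r subr0 mulr1.
    by field.
  have [r [g [N [E [rK pr card cE HE]]]]] := H2 n n2n _ (rows i iI1).
  exists r, g, N; split => //.
  + by rewrite leq_max rK orbT.
  + by apply: card_le_trans card _; rewrite card_le_II; apply: pK; exact: leq_maxr.
  + apply: (@le_trans _ _ #|~: E|%SET%:R).
      rewrite ler_nat; apply: subset_leq_card; apply/fintype.subsetP => j.
      rewrite !inE; apply: contraNN => jE; apply/mem_set; rewrite a'E; exact: HE.
    apply: le_trans (root _ cE) _; rewrite ler_peMl ?powR_ge0 //; lra.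
Qed.
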